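(* Let $\mathcal{G}:X\times\Lambda\to\mathbb{R}^J$ be the groundwater flow forward operator $\mathcal{G}(u,a)=\ell(p_{u,a})$ defined in the context. Then: (1) for each $r>0$ there exists $C(r)>0$ such that for all $u,v\in X$ with $\|u\|_X,\|v\|_X<r$ and all $a\in\Lambda$, $$|\mathcal{G}(u,a)-\mathcal{G}(v,a)|\le C(r)\|u-v\|_X;$$ (2) for each $u\in X$, the map $\mathcal{G}(u,\cdot):\Lambda\to\mathbb{R}^J$ is continuous.
   Context: $D\subseteq\mathbb{R}^d$, $d\in\{1,2,3\}$, is a bounded Lipschitz domain, $\Lambda\subseteq\mathbb{R}^k$, and $A_i:\Lambda\to\mathcal{B}(D)$, $i=1,\dots,N$, are set-valued maps (Borel subsets of $D$) such that for each $a\in\Lambda$ the sets $A_1(a),\dots,A_N(a)$ are pairwise disjoint with union $D$, and which are continuous in the sense that $|a-b|\to0$ implies $|A_i(a)\Delta A_i(b)|\to0$ (Lebesgue measure of the symmetric difference). $X=C^0(D;\mathbb{R}^N)$ is the space of continuous functions on the closure of $D$ with the supremum norm. For $u=(u_1,\dots,u_N)\in X$ and $a\in\Lambda$, $u^a:=\sum_{i=1}^N u_i\mathbf{1}_{A_i(a)}\in L^\infty(D)$. $\sigma:\mathbb{R}\to\mathbb{R}^+$ is a positive continuously differentiable function. $V=H^1(D)$, and $f\in H^{-1}(D)$, $g\in H^{1/2}(\partial D)$ are given. For $(u,a)\in X\times\Lambda$, $p_{u,a}\in V$ is the weak solution of $-\nabla\cdot(\sigma(u^a)\nabla p_{u,a})=f$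 in $D$, $p_{u,a}=g$ on $\partial D$: that is, $p_{u,a}=q_{u,a}+G$ where $G\in V$ has trace $g$ and $q_{u,a}\in H^1_0(D)$ satisfies $\int_D\sigma(u^a)\nabla q_{u,a}\cdot\nabla\varphi=f(\varphi)-\int_D\sigma(u^a)\nabla G\cdot\nabla\varphi$ for all $\varphi\in H_0^1(D)$. $\ell:V\to\mathbb{R}^J$ is a continuous linear observation operator. *)

(* Defs.v *)
From HB Require Import structures.
From mathcomp Require Import all_boot all_order all_algebra.
From mathcomp Require Import all_classical all_reals all_analysis.

Set Implicit Arguments.
Unset Strict Implicit.
Unset Printing Implicit Defensive.

Import Order.TTheory GRing.Theory Num.Theory.
Import numFieldNormedType.Exports.

Local Open Scope classical_set_scope.
Local Open Scope ring_scope.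

(* R^n is the space 'rV[R]_n of row vectors.  It carries the sigma-algebra
   generated by the coordinates, which is its Borel sigma-algebra. *)
Definition rV_display : measure_display. Proof. exact: default_measure_display. Qed.

Section borel_rV.
Context (R : realType) (n : nat).

Let coord (i : 'I_n) (x : 'rV[R]_n) : measurableTypeR R := x ord0 i.

Let borel0 : g_sigma_preimage coord set0.
Proof. exact: sigma_algebra0. Qed.

Let borelC A : g_sigma_preimage coord A -> g_sigma_preimage coord (~` A).
Proof. exact: sigma_algebraC. Qed.

Let borel_bigcup (F : (set 'rV[R]_n)^nat) :
  (forall i, g_sigma_preimage coord (F i)) ->
  g_sigma_preimage coord (\bigcup_i F i).
Proof. exact: sigma_algebra_bigcup. Qed.

HB.instance Definition _ := @isMeasurable.Build rV_display 'rV[R]_n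
  (g_sigma_preimage coord) borel0 borelC borel_bigcup.

Lemma measurable_coord (i : 'I_n) :
  measurable_fun [set: 'rV[R]_n] (fun x : 'rV[R]_n => x ord0 i).
Proof.
move=> _ Y mY; rewrite setTI; apply: sub_sigma_algebra => /=.
rewrite -bigcup_seq/=; exists i => /=; first by rewrite mem_index_enum.
by exists Y => //; rewrite setTI.
Qed.

Lemma measurable_rV d (T : measurableType d) (f : T -> 'rV[R]_n) :
  (forall i, measurable_fun [set: T] (fun t => f t ord0 i)) ->
  measurable_fun [set: T] f.
Proof.
move=> mf _ A mA; rewrite setTI.
have : g_sigma_preimage (fun i => coord i \o f) `<=` measurable.
  apply: smallest_sub; first exact: sigma_algebra_measurable.
  elim/big_ind : _ => // [B C sB sC X [/sB|/sC]//|i _ _ [B mB <-]].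
  exact: mf.
by apply; rewrite g_sigma_preimage_comp; exists A => //; rewrite setTI.
Qed.

End borel_rV.

Definition rV_cons (R : realType) (n : nat)
    (tx : (measurableTypeR R * 'rV[R]_n)%type) : 'rV[R]_n.+1 :=
  \row_i (if unlift ord0 i is Some j then tx.2 ord0 j else tx.1).

Definition rV_uncons (R : realType) (n : nat) (x : 'rV[R]_n.+1) :
    (measurableTypeR R * 'rV[R]_n)%type :=
  (x ord0 ord0, \row_j x ord0 (lift ord0 j)).

Lemma rV_consK (R : realType) n : cancel (@rV_cons R n) (@rV_uncons R n).
Proof.
move=> [t x]; rewrite /rV_uncons/=; congr pair.
  by rewrite mxE unlift_none.
by apply/rowP => j; rewrite !mxE liftK.
Qed.

Lemma measurable_rV_cons (R : realType) n :
  measurable_fun [set: measurableTypeR R * 'rV[R]_n] (@rV_cons R n).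
Proof.
apply: measurable_rV => i; case: (unliftP ord0 i) => [j|] ->.
  rewrite (_ : (fun _ => _) =
      (fun x : 'rV[R]_n => x ord0 j) \o (@snd (measurableTypeR R) _)).
    by apply: measurableT_comp; [exact: measurable_coord|exact: measurable_snd].
  by apply/funext => t /=; rewrite mxE liftK.
rewrite (_ : (fun _ => _) = @fst (measurableTypeR R) 'rV[R]_n).
  exact: measurable_fst.
by apply/funext => t /=; rewrite mxE unlift_none.
Qed.

Lemma measurable_rV_uncons (R : realType) n :
  measurable_fun [set: 'rV[R]_n.+1] (@rV_uncons R n).
Proof.
apply: measurable_fun_pair; first exact: measurable_coord.
apply: measurable_rV => i; under eq_fun do rewrite mxE.
exact: measurable_coord.
Qed.

Section lebesgue_rV_succ.
Context (R : realType) (n : nat).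
Variable m : {sigma_finite_measure set 'rV[R]_n -> \bar R}.

Definition lebesgue_succ : set 'rV[R]_n.+1 -> \bar R :=
  pushforward (@lebesgue_measure R \x m)%E (@rV_cons R n).

Let lebesgue_succ0 : lebesgue_succ set0 = 0%E.
Proof. by rewrite /lebesgue_succ /pushforward preimage_set0 measure0. Qed.

Let lebesgue_succ_ge0 A : (0 <= lebesgue_succ A)%E.
Proof. by rewrite /lebesgue_succ /pushforward; exact: measure_ge0. Qed.

Let lebesgue_succ_additive : semi_sigma_additive lebesgue_succ.
Proof.
move=> F mF tF mUF; rewrite /lebesgue_succ /pushforward preimage_bigcup.
apply: measure_semi_sigma_additive.
- by move=> i; rewrite -[X in measurable X]setTI; exact: measurable_rV_cons.
- apply/trivIsetP => /= i j _ _ ij; rewrite -preimage_setI.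
  by move/trivIsetP : tF => /(_ _ _ _ _ ij) ->//; rewrite preimage_set0.
- rewrite -preimage_bigcup -[X in measurable X]setTI.
  exact: measurable_rV_cons.
Qed.

HB.instance Definition _ := isMeasure.Build _ _ _ lebesgue_succ
  lebesgue_succ0 lebesgue_succ_ge0 lebesgue_succ_additive.

Let lebesgue_succ_sigma_finite : sigma_finite setT lebesgue_succ.
Proof.
have /sigma_finiteP[F [TF ndF Foo]] := sigma_finiteT (@lebesgue_measure R).
have /sigma_finiteP[G [TG ndG Goo]] := sigma_finiteT m.
exists (fun k => @rV_uncons R n @^-1` (F k `*` G k)).
  apply/esym; rewrite -preimage_bigcup -subTset => x _ /=.
  have [i _ Fi] : (\bigcup_k F k) (rV_uncons x).1 by rewrite -TF.
  have [j _ Gj] : (\bigcup_k G k) (rV_uncons x).2 by rewrite -TG.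
  exists (maxn i j) => //; split => /=.
  - by move: Fi; exact/subsetPset/ndF/leq_maxl.
  - by move: Gj; exact/subsetPset/ndG/leq_maxr.
move=> k; have [mF Fk] := Foo k; have [mG Gk] := Goo k; split.
  rewrite -[X in measurable X]setTI; apply: measurable_rV_uncons => //.
  exact: measurableX.
rewrite /lebesgue_succ /pushforward -comp_preimage.
rewrite (_ : _ \o _ = id); last by apply/funext => x; exact: rV_consK.
by rewrite preimage_id product_measure1E// lte_mul_pinfty// ge0_fin_numE.
Qed.

HB.instance Definition _ := Measure_isSigmaFinite.Build _ _ _ lebesgue_succ
  lebesgue_succ_sigma_finite.

End lebesgue_rV_succ.

(* Lebesgue measure on the Borel sets of R^n, as the n-fold product of Lebesgue measure on R. *)
Fixpoint lebesgue (R : realType) (n : nat) :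
    {sigma_finite_measure set 'rV[R]_n -> \bar R} :=
  match n with
  | 0 => \d_(0 : 'rV[R]_0)
  | n'.+1 => lebesgue_succ (lebesgue R n')
  end.

Arguments lebesgue {R n}.

Lemma lebesgue_box (R : realType) (n : nat)
    (A : 'I_n -> set (measurableTypeR R)) :
  (forall i, measurable (A i)) ->
  lebesgue [set x : 'rV[R]_n | forall i, A i (x ord0 i)] =
  (\prod_(i < n) lebesgue_measure (A i))%E.
Proof.
elim: n A => [|n IH] A mA.
  by rewrite big_ord0 /= /dirac indicE mem_set//= => -[].
have mB : measurable [set x : 'rV[R]_n | forall i, A (lift ord0 i) (x ord0 i)].
  rewrite (_ : mkset _ = \bigcap_(i in [set: 'I_n])
      ((fun x : 'rV[R]_n => x ord0 i) @^-1` A (lift ord0 i))).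
    apply: fin_bigcap_measurable => // i _; rewrite -[X in measurable X]setTI.
    by apply: measurable_coord => //; exact: mA.
  by apply/seteqP; split => x Ax i; [move=> _; exact: Ax|exact: (Ax i I)].
rewrite big_ord_recl -IH//= /lebesgue_succ /pushforward -product_measure1E//.
congr ((_ \x _)%E _); apply/seteqP; split => -[t x] /=.
  move=> Ax; split; first by have := Ax ord0; rewrite mxE unlift_none.
  by move=> i; have := Ax (lift ord0 i); rewrite mxE liftK.
move=> [At Ax] i; rewrite mxE; case: (unliftP ord0 i) => [j|] -> //.
Qed.

(* The library norm of 'rV[R]_n is the maximum norm. *)
Definition dotv (R : realType) (n : nat) (x y : 'rV[R]_n) : R :=
  \sum_(i < n) x ord0 i * y ord0 i.

Definition eucl (R : realType) (n : nat) (x : 'rV[R]_n) : R :=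
  Num.sqrt (dotv x x).

Section hausdorff.
Context (R : realType) (n : nat).
Local Open Scope ereal_scope.
Implicit Types A : set 'rV[R]_n.

Definition ediam A : \bar R :=
  ereal_sup [set (eucl (z.1 - z.2)%R)%:E | z in A `*` A].

(* diam(A)^s; the empty set has gauge 0 also when s = 0. *)
Definition gauge (s : nat) A : \bar R :=
  if A == set0 then 0 else ediam A ^+ s.

Definition restricted_gauge (s : nat) (delta : R) A : \bar R :=
  if ediam A <= delta%:E then gauge s A else +oo.

(* All subsets are declared measurable so that the covers of mu_ext are
   arbitrary. *)
Definition discrete_rV : Type := 'rV[R]_n.

HB.instance Definition _ := Pointed.on discrete_rV.

HB.instance Definition _ := @isMeasurable.Build default_measure_display
  discrete_rV setT I (fun _ _ => I) (fun _ _ => I).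

Definition hausdorff_delta (s : nat) (delta : R) (A : set 'rV[R]_n) : \bar R :=
  @mu_ext _ discrete_rV R (restricted_gauge s delta) A.

(* s-dimensional Hausdorff outer measure, up to the usual normalising constant. *)
Definition hausdorff (s : nat) A : \bar R :=
  ereal_sup [set hausdorff_delta s delta A | delta in [set e : R | (0 < e)%R]].

Lemma ediam_ge0 A : A != set0 -> 0 <= ediam A.
Proof.
move=> /set0P[x Ax]; apply: (@le_trans _ _ (eucl (x - x)%R)%:E).
  by rewrite lee_fin sqrtr_ge0.
by apply: ereal_sup_ubound; exists (x, x).
Qed.

Lemma gauge_ge0 s A : 0 <= gauge s A.
Proof. by rewrite /gauge; case: eqVneq => // A0; rewrite expe_ge0 ?ediam_ge0. Qed.

Lemma restricted_gauge_ge0 s delta A : 0 <= restricted_gauge s delta A.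
Proof. by rewrite /restricted_gauge; case: ifP => // _; exact: gauge_ge0. Qed.

Lemma restricted_gauge0 s delta : restricted_gauge s delta set0 = 0.
Proof.
by rewrite /restricted_gauge /ediam setX0 image_set0 ereal_sup0 leNye /gauge eqxx.
Qed.

Let hausdorff0 s : hausdorff s set0 = 0.
Proof.
rewrite /hausdorff (_ : image _ _ = [set 0]) ?ereal_sup1//.
apply/seteqP; split => [_ [e e0 <-]|_ ->]/=.
  apply: mu_ext0; [exact: restricted_gauge0|exact: restricted_gauge_ge0].
exists 1%R; first exact: ltr01.
apply: mu_ext0; [exact: restricted_gauge0|exact: restricted_gauge_ge0].
Qed.

Let hausdorff_ge0 s A : 0 <= hausdorff s A.
Proof.
apply: (@le_trans _ _ (hausdorff_delta s 1 A)).
  by apply: mu_ext_ge0; exact: restricted_gauge_ge0.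
by apply: ereal_sup_ubound; exists 1%R => //=; exact: ltr01.
Qed.

Let le_hausdorff s : {homo hausdorff s : A B / A `<=` B >-> A <= B}.
Proof.
move=> A B AB; apply: ge_ereal_sup => _ [e e0 <-].
apply: (@le_trans _ _ (hausdorff_delta s e B)); first exact: le_mu_ext.
by apply: ereal_sup_ubound; exists e.
Qed.

Let hausdorff_sigma_subadditive s : sigma_subadditive (hausdorff s).
Proof.
move=> F; apply: ge_ereal_sup => _ [e e0 <-].
apply: (@le_trans _ _ (\sum_(i <oo) hausdorff_delta s e (F i))).
  by apply: mu_ext_sigma_subadditive; exact: restricted_gauge_ge0.
apply: lee_nneseries => [i _ _|i _].
  by apply: mu_ext_ge0; exact: restricted_gauge_ge0.
by apply: ereal_sup_ubound; exists e.
Qed.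

HB.instance Definition _ s := isOuterMeasure.Build R 'rV[R]_n (hausdorff s)
  (hausdorff0 s) (hausdorff_ge0 s) (@le_hausdorff s)
  (@hausdorff_sigma_subadditive s).

End hausdorff.
Arguments hausdorff {R n}.

Section domains.
Context (R : realType) (n : nat).
Implicit Types D : set 'rV[R]_n.

Definition frontier D : set 'rV[R]_n := closure D `\` D^°.

(* Near each boundary point, D is the part of a ball lying strictly above the
   graph of a Lipschitz function over the hyperplane orthogonal to a unit
   vector e. *)
Definition lipschitz_boundary D : Prop :=
  forall x, frontier D x ->
  exists (r M : R) (e : 'rV[R]_n) (gamma : 'rV[R]_n -> R),
    [/\ 0 < r, eucl e = 1,
        (forall y z, `|gamma y - gamma z| <= M * eucl (y - z)) &
        (forall y, eucl (y - x) < r ->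
           (D y <-> gamma (y - dotv y e *: e) < dotv y e))].

Definition bounded_lipschitz_domain D : Prop :=
  [/\ D !=set0, open D, connected D, bounded_set D & lipschitz_boundary D].

End domains.

Section sobolev.
Context (R : realType) (d : nat).
Local Notation E := 'rV[R]_d.
Local Notation leb := (@lebesgue R d).
Implicit Types (D : set E) (phi : E -> R).

Definition basis_vec (i : 'I_d) : E := delta_mx ord0 i.

Fixpoint class_C (m : nat) phi : Prop :=
  continuous phi /\
  match m with
  | 0 => True
  | m'.+1 => forall i, (forall x, derivable phi x (basis_vec i)) /\
                       class_C m' ('D_(basis_vec i) phi)
  end.

Definition smooth phi : Prop := forall m, class_C m phi.

Definition grad phi : E -> E := fun x => \row_i 'D_(basis_vec i) phi x.

Definition test_fun D phi : Prop :=
  smooth phi /\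
  exists K : set E, [/\ compact K, K `<=` D & forall x, ~ K x -> phi x = 0].

Definition square_integrable D phi : Prop :=
  measurable_fun D phi /\ (\int[leb]_(x in D) ((phi x) ^+ 2)%:E < +oo)%E.

Definition weak_pderiv D (i : 'I_d) (u w : E -> R) : Prop :=
  forall phi, test_fun D phi ->
    \int[leb]_(x in D) (u x * 'D_(basis_vec i) phi x) =
    - \int[leb]_(x in D) (w x * phi x).

(* An element of H^1(D) is represented by a pair (u, Du), where Du is a weak
   gradient of u.  Since Du is determined by u up to a null set of D, this is
   H^1(D) up to the choice of representatives modulo a.e. equality. *)
Definition jet : Type := ((E -> R^o) * (E -> E))%type.

HB.instance Definition _ := GRing.Lmodule.on jet.

Definition jet_of phi : jet := (phi, grad phi).

Definition H1 D : set jet := [set u : jet |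
  square_integrable D u.1 /\
  forall i, square_integrable D (fun x => u.2 x ord0 i) /\
            weak_pderiv D i u.1 (fun x => u.2 x ord0 i)].

Definition H1_norm D (u : jet) : R :=
  Num.sqrt (\int[leb]_(x in D) (u.1 x ^+ 2) +
            \int[leb]_(x in D) dotv (u.2 x) (u.2 x)).

(* the closure of the test functions in H^1(D) *)
Definition H10 D : set jet := [set u : jet | H1 D u /\
  forall eps : R, 0 < eps ->
    exists2 phi, test_fun D phi & H1_norm D (u - jet_of phi) < eps].

(* L is linear on S and continuous there for the H^1(D) norm; continuity makes
   L depend only on the classes modulo a.e. equality. *)
Definition continuous_linear D (S : set jet) (W : normedModType R)
    (L : jet -> W) : Prop :=
  (forall (c : R) u v, S u -> S v -> L (c *: u + v) = c *: L u + L v) /\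
  (forall u, S u -> forall eps : R, 0 < eps ->
     exists2 delta : R, 0 < delta &
       forall v, S v -> H1_norm D (v - u) < delta -> `|L v - L u| < eps).

(* H^{-1}(D), the dual of H^1_0(D): only the values of f on H10 D matter. *)
Definition Hminus1 D (f : jet -> R^o) : Prop := continuous_linear D (H10 D) f.

(* The surface measure: (d-1)-dimensional Hausdorff measure on its
   Caratheodory sigma-algebra, which contains the Borel sets. *)
Definition surface_type : Type := caratheodory_type (@hausdorff R d d.-1).
HB.instance Definition _ := Measurable.on surface_type.

Definition surface : set surface_type -> \bar R := hausdorff d.-1.

Let surface0 : surface set0 = 0%E.
Proof. exact: outer_measure0. Qed.

Let surface_ge0 A : (0 <= surface A)%E.
Proof. exact: outer_measure_ge0. Qed.

Let surface_additive : semi_sigma_additive surface.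
Proof.
exact: (@caratheodory_measure_sigma_additive _ _
  (@hausdorff R d d.-1 : {outer_measure set 'rV[R]_d -> \bar R})).
Qed.

HB.instance Definition _ := isMeasure.Build _ _ _ surface
  surface0 surface_ge0 surface_additive.

(* g is the trace of u: the limit in L^2 of the boundary of restrictions of
   smooth functions on R^d converging to u in H^1(D). *)
Definition has_trace D (u : jet) (g : E -> R) : Prop :=
  measurable_fun (frontier D : set surface_type) (g : surface_type -> R) /\
  forall eps : R, 0 < eps -> exists phi : E -> R,
    [/\ smooth phi, H1_norm D (u - jet_of phi) < eps &
        (\int[surface]_(x in frontier D) ((phi x - g x) ^+ 2)%:E < eps%:E)%E].

(* the range of the trace operator *)
Definition H_half D (g : E -> R) : Prop := exists2 u, H1 D u & has_trace D u g.

End sobolev.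

Section forward_model.
Context (R : realType) (d N : nat).
Local Notation E := 'rV[R]_d.
Implicit Types (D : set E) (A : 'I_N -> set E) (u : E -> 'rV[R]_N).

Definition CX D u : Prop := {within closure D, continuous u}.

Definition sup_norm D u : R := sup [set eucl (u x) | x in closure D].

(* the function u^a, for A the partition (A_i(a))_i *)
Definition glue A u (x : E) : R := \sum_(i < N) u x ord0 i * \1_(A i) x.

Definition is_partition D A : Prop :=
  [/\ forall i, measurable (A i), trivIset setT A & \bigcup_i A i = D].

(* p = q + G with q in H^1_0(D), where G is a lift to H^1(D) of the Dirichlet
   datum; f is the right-hand side in H^{-1}(D). *)
Definition weak_solution D (sigma : R -> R) (f : @jet R d -> R^o)
    (G : @jet R d) A u (p : @jet R d) : Prop :=
  exists2 q, H10 D q & p = q + G /\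
    forall phi, H10 D phi ->
      \int[lebesgue]_(x in D) (sigma (glue A u x) * dotv (q.2 x) (phi.2 x)) =
      f phi -
      \int[lebesgue]_(x in D) (sigma (glue A u x) * dotv (G.2 x) (phi.2 x)).

Definition forward_op (J k : nat) (ell : @jet R d -> 'rV[R]_J)
    (p : (E -> 'rV[R]_N) -> 'rV[R]_k -> @jet R d) u (a : 'rV[R]_k) : 'rV[R]_J :=
  ell (p u a).

End forward_model.

(* Main.v *)
(** Subtracting the weak formulations for two coefficients [k1], [k2] and testing
    with the difference [w] of the solutions gives
    [int k1 |grad w|^2 = int (k2 - k1) grad p2 . grad w], whence
    [c ||grad w|| <= ||(k2 - k1) grad p2||] for [c] a lower bound of [k1].
    With the energy bound on [grad p2] and the Poincare inequality on H^1_0,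
    the Lipschitz bound (1) follows because [sigma] is Lipschitz on [[-r, r]].
    For (2), [k2 - k1] is bounded and vanishes outside the union of the
    symmetric differences [A_i(a) Delta A_i(b)], so the right-hand side tends to
    zero by absolute continuity of the integral of [|grad p2|^2]. *)
Require Import Defs.
From mathcomp Require Import all_boot all_order all_algebra.
From mathcomp Require Import all_classical all_reals all_analysis.
From mathcomp Require Import measurable_realfun ring lra.

Set Implicit Arguments.
Unset Strict Implicit.
Unset Printing Implicit Defensive.

Import Order.TTheory GRing.Theory Num.Theory.
Import numFieldNormedType.Exports.
Local Open Scope classical_set_scope.
Local Open Scope ring_scope.

(** * Semi-inner products and square-integrable functions *)

(** A jet is a pair of functions, not a class modulo null sets, so [H1_norm] is only a seminorm, and
    its algebra is valid only where the integrals converge. Inner products are therefore handled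
    relative to explicit subspaces, and a seminorm that may vanish on a nonzero jet is never divided
    by without separating that case or perturbing it. The Poincare inequality rests on the factor
    x_i, whose i-th derivative is 1 and which is bounded because D is: a single integration by
    parts, available through the definition of the weak derivative, replaces integration along
    lines. The stability estimate is asymmetric: its right-hand side contains the gradient of the
    second solution only. In (1) this gradient is bounded by a constant depending on the coefficient
    only through its bounds on [-r, r], hence uniform in u and a. In (2) the second solution is the
    one at the limit parameter, so a single fixed function is integrated over small sets and the
    threshold from absolute continuity does not move with a. *)

Section semi_inner.
Context (R : realType) (V : lmodType R).
Implicit Types (S : set V) (B : V -> V -> R).

Definition subspace_set S :=
  S 0 /\ forall (c : R) u v, S u -> S v -> S (c *: u + v).

(** Everything is relative to [S] because the integrals used below are additive only on integrable
    functions. Definiteness is not asked for: functions that vanish almost everywhere have seminorm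
    0. *)
Definition semi_inner S B : Prop :=
  [/\ subspace_set S,
      forall (c : R) u v w, S u -> S v -> S w ->
        B (c *: u + v) w = c * B u w + B v w,
      forall u v, S u -> S v -> B u v = B v u &
      forall u, S u -> 0 <= B u u].

Definition semi_norm B u : R := Num.sqrt (B u u).

Lemma subspace_setD {S} (u v : V) : subspace_set S -> S u -> S v -> S (u + v).
Proof. by case=> _ SS Su Sv; rewrite -[u]scale1r; exact: SS. Qed.

Lemma subspace_setZ {S} (c : R) (u : V) : subspace_set S -> S u -> S (c *: u).
Proof. by case=> S0 SS Su; rewrite -[_ *: _]addr0; exact: SS. Qed.

Lemma subspace_setB {S} (u v : V) : subspace_set S -> S u -> S v -> S (u - v).
Proof.
by case=> _ SS Su Sv; rewrite addrC -scaleN1r; exact: SS.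
Qed.

Lemma semi_norm_ge0 B u : 0 <= semi_norm B u.
Proof. exact: sqrtr_ge0. Qed.

Variables (S : set V) (B : V -> V -> R).
Hypothesis HB : semi_inner S B.

Let subS : subspace_set S. Proof. by case: HB. Qed.

Lemma semi_normE u : S u -> semi_norm B u ^+ 2 = B u u.
Proof. by move=> Su; case: HB => _ _ _ p; rewrite sqr_sqrtr ?p. Qed.

Lemma semi_innerZDl c u v w : S u -> S v -> S w ->
  B (c *: u + v) w = c * B u w + B v w.
Proof. by case: HB => _ + _ _; apply. Qed.

Lemma semi_innerDl u v w : S u -> S v -> S w -> B (u + v) w = B u w + B v w.
Proof. by move=> *; rewrite -[u in LHS]scale1r semi_innerZDl// mul1r. Qed.

Lemma semi_innerBl u v w : S u -> S v -> S w -> B (u - v) w = B u w - B v w.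
Proof.
by move=> *; rewrite addrC -scaleN1r semi_innerZDl// mulN1r addrC.
Qed.

Lemma semi_innerC u v : S u -> S v -> B u v = B v u.
Proof. by case: HB => _ _ + _; apply. Qed.

Lemma semi_innerZD_sqr c u v : S u -> S v ->
  B (c *: u + v) (c *: u + v) = c ^+ 2 * B u u + c * (2 * B u v) + B v v.
Proof.
move=> Su Sv; have Sw : S (c *: u + v) by case: subS => _; apply.
rewrite semi_innerZDl// !(@semi_innerC _ (c *: u + v))//.
rewrite !semi_innerZDl// (@semi_innerC v u)//; ring.
Qed.

Lemma cauchy_schwarz u v : S u -> S v ->
  `|B u v| <= semi_norm B u * semi_norm B v.
Proof.
move=> Su Sv; rewrite -(@ler_pXn2r _ 2)// ?nnegrE ?mulr_ge0 ?semi_norm_ge0//.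
rewrite exprMn !semi_normE// real_normK ?num_real//.
have P c : 0 <= c ^+ 2 * B u u + c * (2 * B u v) + B v v.
  rewrite -semi_innerZD_sqr//; case: HB => _ _ _; apply.
  by case: subS => _; apply.
have Bu : 0 <= B u u by case: HB => _ _ _; apply.
have [Bu0|Bu0] := eqVneq (B u u) 0.
  have [->|Buv] := eqVneq (B u v) 0; first by rewrite expr0n/= Bu0 mul0r.
  (* With [B u u = 0] the polynomial is affine in c with nonzero slope; this c gives it the value
     -1. *)
  have := P (- (B v v + 1) / (2 * B u v)).
  rewrite Bu0 mulr0 add0r divfK ?mulf_neq0 ?pnatr_eq0//; lra.
have {}Bu : 0 < B u u by rewrite lt_def Bu0.
(* The minimiser of the quadratic polynomial. *)
have := P (- B u v / B u u).
have -> : (- B u v / B u u) ^+ 2 * B u u + - B u v / B u u * (2 * B u v) + B v v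
  = B v v - B u v ^+ 2 / B u u by field.
by rewrite subr_ge0 ler_pdivrMr// mulrC.
Qed.

Lemma semi_normD u v : S u -> S v ->
  semi_norm B (u + v) <= semi_norm B u + semi_norm B v.
Proof.
move=> Su Sv; rewrite -(@ler_pXn2r _ 2)// ?nnegrE ?addr_ge0 ?semi_norm_ge0//.
rewrite semi_normE; last exact: subspace_setD.
rewrite -[u in leLHS]scale1r semi_innerZD_sqr// expr1n !mul1r sqrrD !semi_normE//.
rewrite lerD2r lerD2l -[leRHS]mulr_natl ler_pM2l//.
exact: le_trans (ler_norm _) (cauchy_schwarz Su Sv).
Qed.

Lemma semi_normZ c u : S u -> semi_norm B (c *: u) = `|c| * semi_norm B u.
Proof.
move=> Su; apply/eqP; rewrite -(@eqrXn2 _ 2)// ?mulr_ge0 ?semi_norm_ge0//.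
have S0 : S 0 by case: subS.
rewrite exprMn !semi_normE//; last exact: subspace_setZ.
have B0w w : S w -> B 0 w = 0.
  by move=> Sw; have := semi_innerDl S0 S0 Sw; rewrite addr0; lra.
have := semi_innerZD_sqr c Su S0.
rewrite addr0 => ->; rewrite (semi_innerC Su S0)// !B0w// real_normK ?num_real//.
by rewrite !mulr0 !addr0.
Qed.

Lemma semi_norm0 : semi_norm B 0 = 0.
Proof.
have S0 : S 0 by case: subS.
by have := semi_normZ 0 S0; rewrite scale0r normr0 mul0r.
Qed.

Lemma semi_normBC u v : S u -> S v -> semi_norm B (u - v) = semi_norm B (v - u).
Proof.
move=> Su Sv; have := semi_normZ (-1) (subspace_setB subS Sv Su).
by rewrite scaleN1r opprB normrN1 mul1r.
Qed.

Lemma semi_normB_le u v : S u -> S v ->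
  semi_norm B u <= semi_norm B v + semi_norm B (u - v).
Proof.
move=> Su Sv; rewrite -[u in leLHS](subrK v) addrC; apply: semi_normD => //.
exact: subspace_setB.
Qed.

End semi_inner.

(** * Semi-inner products of L^2 functions, vector fields and jets *)

Section L2.
Context (R : realType) (n : nat).
Local Notation E := 'rV[R]_n.
Local Notation leb := (@lebesgue R n).
Variable D : set E.
Hypothesis mD : measurable D.
Local Notation sqi := (square_integrable D).
Implicit Types f g k : E -> R.

Lemma integrable_scale (c : R) f : leb.-integrable D (EFin \o f) ->
  leb.-integrable D (EFin \o (fun x => c * f x)).
Proof. exact: integrableZl. Qed.

Lemma sqr_integrable f : sqi f ->
  leb.-integrable D (EFin \o (fun x => f x ^+ 2)).
Proof.
move=> [mf foo]; apply/integrableP; split.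
  by apply/measurable_EFinP; exact: measurable_funX.
under eq_integral do rewrite gee0_abs ?lee_fin ?sqr_ge0//.
exact: foo.
Qed.

Lemma integrable_square_integrable f : measurable_fun D f ->
  leb.-integrable D (EFin \o (fun x => f x ^+ 2)) -> sqi f.
Proof.
move=> mf /integrableP[_ foo]; split => //; apply: le_lt_trans foo.
by under [leRHS]eq_integral do rewrite gee0_abs ?lee_fin ?sqr_ge0//.
Qed.

(** The product is dominated by f^2 + g^2. *)
Lemma square_integrableM f g : sqi f -> sqi g ->
  leb.-integrable D (EFin \o (fun x => f x * g x)).
Proof.
move=> sf sg; have [mf _] := sf; have [mg _] := sg.
have := integrableD mD (sqr_integrable sf) (sqr_integrable sg).
apply: le_integrable => //.
  by apply/measurable_EFinP; exact: measurable_funM.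
move=> x _; rewrite lee_fin /= [leRHS]ger0_norm ?addr_ge0 ?sqr_ge0//.
rewrite ler_norml; apply/andP; split; nra.
Qed.

Lemma square_integrable_le f g : measurable_fun D f -> sqi g ->
  (forall x, D x -> `|f x| <= `|g x|) -> sqi f.
Proof.
move=> mf sg fg; apply: integrable_square_integrable => //.
apply: le_integrable (sqr_integrable sg) => //.
  by apply/measurable_EFinP; exact: measurable_funX.
move=> x Dx /=; rewrite lee_fin !normrX; apply: lerXn2r; rewrite ?nnegrE//.
exact: fg.
Qed.

Lemma square_integrableD c f g : sqi f -> sqi g -> sqi (fun x => c * f x + g x).
Proof.
move=> sf sg; have [mf _] := sf; have [mg _] := sg.
apply: integrable_square_integrable.
  by apply: measurable_funD => //; exact: measurable_funM.
rewrite (_ : _ \o _ = (fun x => (c ^+ 2)%:E * (f x ^+ 2)%:E +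
   ((2 * c)%:E * (f x * g x)%:E + (g x ^+ 2)%:E))%E); last first.
  by apply/funext => x /=; rewrite -!EFinM -!EFinD; congr EFin; ring.
apply: integrableD => //; first exact/integrableZl/sqr_integrable.
apply: integrableD => //; last exact: sqr_integrable.
exact/integrableZl/square_integrableM.
Qed.

Lemma square_integrable0 : sqi (fun=> 0).
Proof.
split; first exact: measurable_cst.
by under eq_integral do rewrite expr0n/=; rewrite integral0.
Qed.

Lemma square_integrable_mulb k f M : measurable_fun D k ->
  (forall x, D x -> `|k x| <= M) -> sqi f -> sqi (fun x => k x * f x).
Proof.
move=> mk kM sf; have [mf _] := sf.
(* The dominating function is M f, written as the combination M f + 0. The sign of M is free, since
   |k| <= M <= |M|. *)
have sMf := square_integrableD M sf square_integrable0.
apply: square_integrable_le sMf _; first exact: measurable_funM.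
move=> x Dx; rewrite addr0 !normrM ler_wpM2r//.
exact: le_trans (kM _ Dx) (ler_norm _).
Qed.

(** The codomain [R^o] gives the function space its module structure, which [semi_inner]
    requires. *)
Definition L2s : set (E -> R^o) := square_integrable D.

Definition L2v : set (E -> E) :=
  [set F : E -> E | forall i, square_integrable D (fun x => F x ord0 i)].

(** The largest space on which [H1_norm] behaves as a seminorm; the two components need not be
    linked by a weak derivative. *)
Definition L2jet : set (jet R n) := [set u : jet R n | L2s u.1 /\ L2v u.2].

Definition inner_s (f g : E -> R^o) : R := \int[leb]_(x in D) (f x * g x).

Definition inner_v (F G : E -> E) : R := \int[leb]_(x in D) dotv (F x) (G x).

Definition inner_jet (u v : jet R n) : R := inner_s u.1 v.1 + inner_v u.2 v.2.

Lemma dotv_integrable F G : L2v F -> L2v G ->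
  leb.-integrable D (EFin \o (fun x => dotv (F x) (G x))).
Proof.
move=> sF sG; rewrite (_ : _ \o _ =
    fun x => (\sum_(i < n) (F x ord0 i * G x ord0 i)%:E)%E); last first.
  by apply/funext => x /=; rewrite sumEFin.
apply: integrable_sum => // i _.
exact: square_integrableM (sF i) (sG i).
Qed.

Lemma dotvZDl (c : R) (x y z : E) : dotv (c *: x + y) z = c * dotv x z + dotv y z.
Proof.
rewrite /dotv mulr_sumr -big_split/=; apply: eq_bigr => i _.
by rewrite !mxE mulrDl mulrA.
Qed.

Lemma dotvZl (c : R) (x y : E) : dotv (c *: x) y = c * dotv x y.
Proof. by rewrite /dotv mulr_sumr; apply: eq_bigr => i _; rewrite mxE mulrA. Qed.

Lemma dotvC (x y : E) : dotv x y = dotv y x.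
Proof. by apply: eq_bigr => i _; rewrite mulrC. Qed.

Lemma dotvv_ge0 (x : E) : 0 <= dotv x x.
Proof. by apply: sumr_ge0 => i _; rewrite -expr2 sqr_ge0. Qed.

Lemma subspace_L2s : subspace_set L2s.
Proof.
by split=> [|c u v su sv]; [exact: square_integrable0|exact: square_integrableD].
Qed.

Lemma subspace_L2v : subspace_set L2v.
Proof.
split=> [i|c u v su sv i].
  by under eq_fun do rewrite mxE; exact: square_integrable0.
rewrite (_ : (fun _ => _) = fun x => c * u x ord0 i + v x ord0 i).
  exact: square_integrableD.
by apply/funext => x; rewrite !mxE.
Qed.

Lemma subspace_L2jet : subspace_set L2jet.
Proof.
have [s0 s] := subspace_L2s; have [v0 v] := subspace_L2v.
split=> [//|c u w [su1 su2] [sw1 sw2]].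
by split; [exact: s|exact: v].
Qed.

Lemma semi_inner_s : semi_inner L2s inner_s.
Proof.
split; first exact: subspace_L2s.
- move=> c u v w su sv sw; rewrite /inner_s -RintegralZl//; last first.
    exact: square_integrableM.
  rewrite -RintegralD//.
  + by apply: eq_Rintegral => x _; rewrite mulrA -mulrDl.
  + exact/integrable_scale/square_integrableM.
  + exact: square_integrableM.
- by move=> u v _ _; apply: eq_Rintegral => x _; rewrite mulrC.
- by move=> u _; apply: Rintegral_ge0 => x _; rewrite -expr2 sqr_ge0.
Qed.

Lemma semi_inner_v : semi_inner L2v inner_v.
Proof.
split; first exact: subspace_L2v.
- move=> c u v w su sv sw; rewrite /inner_v -RintegralZl//; last first.
    exact: dotv_integrable.
  rewrite -RintegralD//.
  + by apply: eq_Rintegral => x _; rewrite -dotvZDl.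
  + exact/integrable_scale/dotv_integrable.
  + exact: dotv_integrable.
- by move=> u v _ _; apply: eq_Rintegral => x _; rewrite dotvC.
- by move=> u _; apply: Rintegral_ge0 => x _; exact: dotvv_ge0.
Qed.

Lemma semi_inner_jet : semi_inner L2jet inner_jet.
Proof.
have [_ s1 s2 s3] := semi_inner_s; have [_ v1 v2 v3] := semi_inner_v.
split; first exact: subspace_L2jet.
- move=> c u v w [? ?] [? ?] [? ?]; rewrite /inner_jet [LHS]/=.
  by rewrite s1// v1// mulrDr addrACA.
- by move=> u v [? ?] [? ?]; rewrite /inner_jet s2// v2.
- by move=> u [? ?]; rewrite addr_ge0 ?s3 ?v3.
Qed.

Lemma H1_normE u : H1_norm D u = semi_norm inner_jet u.
Proof. by []. Qed.

Lemma H1_normD u v : L2jet u -> L2jet v ->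
  H1_norm D (u + v) <= H1_norm D u + H1_norm D v.
Proof. exact: (semi_normD semi_inner_jet). Qed.

Lemma H1_normZ c u : L2jet u -> H1_norm D (c *: u) = `|c| * H1_norm D u.
Proof. exact: (semi_normZ semi_inner_jet). Qed.

Lemma H1_norm0 : H1_norm D 0 = 0.
Proof. exact: (semi_norm0 semi_inner_jet). Qed.

Lemma norm_s_le u : L2jet u -> semi_norm inner_s u.1 <= H1_norm D u.
Proof.
move=> [_ s2]; rewrite H1_normE ler_wsqrtr// lerDl.
by case: semi_inner_v => _ _ _; apply.
Qed.

Lemma norm_v_le u : L2jet u -> semi_norm inner_v u.2 <= H1_norm D u.
Proof.
move=> [s1 _]; rewrite H1_normE ler_wsqrtr// lerDr.
by case: semi_inner_s => _ _ _; apply.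
Qed.

Lemma H1_norm_le u : L2jet u ->
  H1_norm D u <= semi_norm inner_s u.1 + semi_norm inner_v u.2.
Proof.
move=> [s1 s2]; rewrite H1_normE -(@ler_pXn2r _ 2)//; last first.
- by rewrite nnegrE addr_ge0 ?semi_norm_ge0.
- by rewrite nnegrE semi_norm_ge0.
rewrite (semi_normE semi_inner_jet)// sqrrD.
rewrite (semi_normE semi_inner_s)// (semi_normE semi_inner_v)//.
by rewrite addrAC lerDl mulrn_wge0// mulr_ge0 ?semi_norm_ge0.
Qed.

Lemma L2v_mulb k F M : measurable_fun D k ->
  (forall x, D x -> `|k x| <= M) -> L2v F -> L2v (fun x => k x *: F x).
Proof.
move=> mk kM sF i; under eq_fun do rewrite mxE.
exact: square_integrable_mulb mk kM (sF i).
Qed.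

Lemma L2s_mulb k f M : measurable_fun D k ->
  (forall x, D x -> `|k x| <= M) -> L2s f -> L2s (fun x => k x * f x).
Proof. exact: square_integrable_mulb. Qed.

Lemma norm_s_mulb k f M : 0 <= M -> measurable_fun D k ->
  (forall x, D x -> `|k x| <= M) -> L2s f ->
  semi_norm inner_s (fun x => k x * f x) <= M * semi_norm inner_s f.
Proof.
move=> M0 mk kM sf; rewrite -(@ler_pXn2r _ 2)//; last first.
- by rewrite nnegrE mulr_ge0 ?semi_norm_ge0.
- by rewrite nnegrE semi_norm_ge0.
have skf := L2s_mulb mk kM sf.
rewrite exprMn !(semi_normE semi_inner_s)// -RintegralZl//; last first.
  exact: square_integrableM.
apply: le_Rintegral => //.
- exact: square_integrableM.
- exact/integrable_scale/square_integrableM.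
- move=> x Dx; rewrite mulrACA -!expr2 ler_wpM2r ?sqr_ge0//.
  by rewrite -[_ ^+ 2]real_normK ?num_real// lerXn2r ?nnegrE// kM.
Qed.

Lemma norm_v_mulb k F M : 0 <= M -> measurable_fun D k ->
  (forall x, D x -> `|k x| <= M) -> L2v F ->
  semi_norm inner_v (fun x => k x *: F x) <= M * semi_norm inner_v F.
Proof.
move=> M0 mk kM sF; rewrite -(@ler_pXn2r _ 2)//; last first.
- by rewrite nnegrE mulr_ge0 ?semi_norm_ge0.
- by rewrite nnegrE semi_norm_ge0.
have skF := L2v_mulb mk kM sF.
rewrite exprMn !(semi_normE semi_inner_v)// -RintegralZl//; last first.
  exact: dotv_integrable.
apply: le_Rintegral => //.
- exact: dotv_integrable.
- exact/integrable_scale/dotv_integrable.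
- move=> x Dx; rewrite dotvZl dotvC dotvZl mulrA -expr2 ler_wpM2r ?dotvv_ge0//.
  by rewrite -[_ ^+ 2]real_normK ?num_real// lerXn2r ?nnegrE// kM.
Qed.

End L2.

(** * Borel sets of R^n and bounded domains *)

Section borel_rV_open.
Context (R : realType) (n : nat).
Local Notation E := 'rV[R]_n.

Lemma measurable_ball_rV (x : E) (e : R) : measurable (ball x e).
Proof.
(* A ball of nonpositive radius is treated apart: it is empty, whereas for n = 0 the intersection
   over coordinates would be the whole space. *)
have [e0|e0] := ltP 0 e; last first.
  rewrite (_ : ball x e = set0) ?measurable0//.
  by apply/seteqP; split=> // y [] /(le_lt_trans e0); rewrite ltxx.
rewrite (_ : ball x e = \bigcap_(i in [set: 'I_n])
    ((fun y : E => y ord0 i) @^-1` ball (x ord0 i) e)); last first.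
  apply/seteqP; split=> y; first by move=> [_ xy] i _; exact: xy.
  by move=> xy; split=> // i j; rewrite (ord1 i); exact: xy.
apply: fin_bigcap_measurable => // i _; rewrite -[X in measurable X]setTI.
by apply: measurable_coord => //; exact: measurable_ball.
Qed.

(** The sigma-algebra is generated by the coordinates, so U is written as the countable union of the
    balls with rational centre and radius that it contains; balls of the maximum norm are boxes. *)
Lemma open_measurable_rV (U : set E) : open U -> measurable U.
Proof.
move=> oU; pose F (qr : 'rV[rat]_n * rat) : set E :=
  let b := ball (map_mx (@ratr R) qr.1) (ratr qr.2 : R) in
  if `[< b `<=` U >] then b else set0.
rewrite (_ : U = \bigcup_qr F qr).
  apply: countable_bigcupT_measurable; first exact: countableP.
  move=> qr; rewrite /F; case: ifP => _; last exact: measurable0.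
  exact: measurable_ball_rV.
apply/seteqP; split=> [x Ux|x [qr _]]; last first.
  by rewrite /F; case: asboolP => // + Fx; apply.
have /nbhs_ballP[e /= e0 xeU] : nbhs x U by exact: open_nbhs_nbhs.
(* Below half of e, a ball of radius r whose centre is within r of x stays inside the ball of radius
   e around x. *)
have [r] : exists r : rat, ratr r \in `]0, e / 2[%R.
  by apply: rat_in_itvoo; rewrite divr_gt0.
rewrite in_itv/= => /andP[r0 re].
have /choice[q qP] : forall i, exists q : rat,
    ratr q \in `]x ord0 i - ratr r, x ord0 i + ratr r[%R.
  by move=> i; apply: rat_in_itvoo; lra.
have xq i : `|ratr (q i) - x ord0 i| < ratr r.
  by rewrite ltr_distl; have := qP i; rewrite in_itv.
exists (\row_i q i, r) => //; rewrite /F/= asboolT.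
  by split=> // i j; rewrite !mxE (ord1 i); exact: xq.
move=> y [_ qy]; apply: xeU; split=> // i j; rewrite (ord1 i).
have := qy ord0 j; rewrite !mxE => /= qy'; have xqj := xq j.
rewrite /ball/=; have := ler_distD (ratr (q j)) (x ord0 j) (y ord0 j).
rewrite (distrC (x ord0 j) (ratr _)); move: qy'; rewrite /ball/=; lra.
Qed.

Lemma continuous_measurable_rV (D : set E) (f : E -> R) : open D ->
  {within D, continuous f} -> measurable_fun D f.
Proof.
move=> oD; rewrite continuous_open_subspace// => cf.
apply: (measurability _ (RGenOpens.measurableE R)).
move=> _ [_ [a [b ->] <-]]; apply: open_measurable_rV.
rewrite openE => x [Dx fx]; apply: filterI; first exact: open_nbhs_nbhs.
apply: (cf x (mem_set Dx)).
by apply: open_nbhs_nbhs; split=> //; exact: interval_open.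
Qed.

Lemma bounded_closure_compact (D : set E) : bounded_set D -> compact (closure D).
Proof.
move=> /ex_strict_bound_gt0[M M0 DM].
apply: bounded_closed_compact; last exact: closed_closure.
exists M; split; first exact: num_real.
move=> m Mm x /closureS Dx; apply: le_trans (ltW Mm).
have : closed_ball_ Num.norm (0 : E) M x.
  have /closure_id -> : closed (closed_ball_ Num.norm (0 : E) M).
    exact: closed_closed_ball_.
  apply: Dx => y Dy; rewrite /closed_ball_/= sub0r normrN ltW//.
  exact: DM.
by rewrite /closed_ball_/= sub0r normrN.
Qed.

Lemma coord_le_norm (x : E) i : `|x ord0 i| <= `|x|.
Proof.
by rewrite [leRHS]/Num.norm/= mx_normrE; apply: (le_bigmax _ _ (ord0, i)).
Qed.

Lemma lebesgue_bounded_fin (D : set E) : measurable D -> bounded_set D ->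
  (lebesgue D < +oo)%E.
Proof.
move=> mD /ex_strict_bound_gt0[M M0 DM].
have mI : measurable (`[- M, M]%classic : set (measurableTypeR R)).
  exact: measurable_itv.
have mB : measurable [set x : E | forall i, `[- M, M]%classic (x ord0 i)].
  rewrite (_ : mkset _ = \bigcap_(i in [set: 'I_n])
      ((fun x : E => x ord0 i) @^-1` `[- M, M]%classic)).
    apply: fin_bigcap_measurable => // i _; rewrite -[X in measurable X]setTI.
    exact: measurable_coord.
  by apply/seteqP; split => x Ax i; [move=> _; exact: Ax|exact: (Ax i I)].
apply: (@le_lt_trans _ _ (lebesgue
    [set x : E | forall i, `[- M, M]%classic (x ord0 i)])).
  apply: le_measure; rewrite ?inE//.
  move=> x Dx i /=; rewrite in_itv/= -ler_norml.
  by apply: le_trans (coord_le_norm x i) _; apply: ltW; exact: DM.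
have -> := @lebesgue_box R n (fun=> `[- M, M]%classic) (fun=> mI).
have fin_lt (x : \bar R) : x \is a fin_num -> (x < +oo)%E.
  by rewrite fin_numElt => /andP[].
apply: fin_lt.
elim/big_ind : _ => // [x y|i _]; first exact: fin_numM.
by rewrite lebesgue_measure_itv/=; case: ifP.
Qed.

(** f is bounded on the compact closure, and the constant 1 is square integrable because D has
    finite measure; then f = f * 1. *)
Lemma continuous_square_integrable (D : set E) (f : E -> R) :
  open D -> bounded_set D -> {within closure D, continuous f} ->
  square_integrable D f.
Proof.
move=> oD bD cf; have mD := open_measurable_rV oD.
have mf : measurable_fun D f.
  apply: continuous_measurable_rV => //.
  exact: continuous_subspaceW (@subset_closure _ D) cf.
have [M M0 fM] : exists2 M, 0 < M & forall x, D x -> `|f x| < M.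
  have /compact_bounded/ex_strict_bound_gt0[M M0 fM] :=
    continuous_compact cf (bounded_closure_compact bD).
  by exists M => // x /subset_closure Dx; apply: fM; exists x.
have s1 : square_integrable D (cst 1).
  split; first exact: measurable_cst.
  under eq_integral do rewrite expr1n.
  rewrite integral_cst// mul1e; exact: lebesgue_bounded_fin.
have := square_integrable_mulb mD mf (fun x Dx => ltW (fM x Dx)) s1.
by under eq_fun do rewrite mulr1.
Qed.

End borel_rV_open.

(** * Test functions *)

Section test_functions.
Context (R : realType) (d : nat).
Local Notation E := 'rV[R]_d.
Implicit Types (phi psi : E -> R) (D : set E).

Lemma class_C_continuous m phi : class_C m phi -> continuous phi.
Proof. by case: m => [|m] []. Qed.

Lemma class_CW m phi : class_C m.+1 phi -> class_C m phi.
Proof.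
elim: m phi => [|m IH] phi; first by case.
by move=> [cphi dphi]; split=> // i; have [dr /IH] := dphi i.
Qed.

Lemma derive_lincomb c phi psi (x v : E) : derivable phi x v ->
  derivable psi x v -> is_derive x v (fun y => c * phi y + psi y)
    (c * 'D_v phi x + 'D_v psi x).
Proof.
move=> dphi dpsi.
apply: (@is_deriveD _ _ _ (c \*: phi) psi); last exact: derivableP.
by apply: is_deriveZ; exact: derivableP.
Qed.

Lemma class_C_lincomb m c phi psi : class_C m phi -> class_C m psi ->
  class_C m (fun x => c * phi x + psi x).
Proof.
have cont f g : continuous f -> continuous g ->
    continuous (fun x : E => c * f x + g x).
  move=> cf cg x; apply: (@continuousD _ _ _ (fun y : E => c * f y) g x);
    last exact: cg.
  by apply: (@continuousM _ _ (cst c) f x); [exact: cst_continuous|exact: cf].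
elim: m phi psi => [|m IH] phi psi [cphi dphi] [cpsi dpsi].
  by split=> //; exact: (cont phi psi).
split=> [|i]; first exact: (cont phi psi).
have [phi1 phi2] := dphi i; have [psi1 psi2] := dpsi i; split.
  by move=> x; have [] := derive_lincomb c (phi1 x) (psi1 x).
rewrite (_ : 'D__ _ =
    fun x => c * 'D_(basis_vec R i) phi x + 'D_(basis_vec R i) psi x).
  exact: IH.
by apply/funext => x; have [_ ->] := derive_lincomb c (phi1 x) (psi1 x).
Qed.

Lemma is_derive_coord (j : 'I_d) (x v : E) :
  is_derive x v (fun y : E => y ord0 j) (v ord0 j).
Proof.
have cv : h^-1 *: (((fun y : E => y ord0 j) \o shift x) (h *: v) - x ord0 j)
    @[h --> 0^'] --> v ord0 j.
  (* For h different from 0 the difference quotient is exactly the j-th coordinate of v. *)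
  apply: cvg_near_cst; near=> h.
  rewrite /= !mxE addrK scalerA mulVf ?scale1r//.
  by near: h; exact: nbhs_dnbhs_neq.
by apply: DeriveDef; [apply/cvg_ex; exists (v ord0 j)|exact: cvg_lim].
Unshelve. all: by end_near. Qed.

(** By the Leibniz rule a partial derivative of x_j phi is a constant times phi plus x_j times a
    partial derivative of phi, so the induction closes without a product rule for general factors.
    This makes x_j phi an admissible test function in the Poincare inequality. *)
Lemma class_C_coordM m (j : 'I_d) phi : class_C m phi ->
  class_C m (fun x => x ord0 j * phi x).
Proof.
have cont f : continuous f -> continuous (fun x : E => x ord0 j * f x).
  move=> cf x; apply: (@continuousM _ _ (fun y : E => y ord0 j) f x).
    exact: coord_continuous.
  exact: cf.
elim: m phi => [|m IH] phi [cphi dphi]; first by split=> //; exact: (cont phi).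
split=> [|i]; first exact: (cont phi).
have [phi1 phi2] := dphi i.
pose D_i := 'D_(basis_vec R i) phi.
have dM x : is_derive x (basis_vec R i) (fun x => x ord0 j * phi x)
    (basis_vec R i ord0 j * phi x + x ord0 j * D_i x).
  have h1 := is_derive_coord j x (basis_vec R i).
  have h2 := derivableP (phi1 x).
  apply: is_derive_eq (is_deriveM h1 h2) _.
  by rewrite /GRing.scale/= addrC mulrC.
split=> [x|]; first by have [] := dM x.
rewrite (_ : 'D__ _ = fun x => basis_vec R i ord0 j * phi x + x ord0 j * D_i x).
  apply: class_C_lincomb; last exact: IH.
  by apply: class_CW; split.
by apply/funext => x; have [_ ->] := dM x.
Qed.

Lemma rV_compactU (K L : set E) : compact K -> compact L -> compact (K `|` L).
Proof.
move=> cK cL; apply: bounded_closed_compact.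
  have /ex_strict_bound_gt0[M M0 KM] := compact_bounded cK.
  have /ex_strict_bound_gt0[N N0 LN] := compact_bounded cL.
  exists (M + N); split; first exact: num_real.
  move=> m Mm x [/KM|/LN] /= xM; apply: ltW; apply: lt_trans Mm;
    apply: lt_trans xM _; lra.
by apply: closedU; apply: compact_closed => //; exact: norm_hausdorff.
Qed.

Lemma test_fun0 D : test_fun D (fun=> 0).
Proof.
split; last by exists set0; split=> //; exact: compact0.
have D0 i : 'D_(basis_vec R i) (fun=> 0 : R) = (fun=> 0) :> (E -> R).
  by apply/funext => x; exact: derive_cst.
elim=> [|m IH]; split=> //; try exact: cst_continuous.
by move=> i; split=> [x|]; [exact: derivable_cst|rewrite D0].
Qed.

Lemma test_fun_lincomb D c phi psi : test_fun D phi -> test_fun D psi ->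
  test_fun D (fun x => c * phi x + psi x).
Proof.
move=> [sphi [K [cK KD K0]]] [spsi [L [cL LD L0]]].
split; first by move=> m; exact: class_C_lincomb.
exists (K `|` L); split; first exact: rV_compactU.
  by move=> x [/KD|/LD].
by move=> x /not_orP[Kx Lx]; rewrite K0// L0// mulr0 addr0.
Qed.

Lemma test_fun_coordM D j phi : test_fun D phi ->
  test_fun D (fun x => x ord0 j * phi x).
Proof.
move=> [sphi [K [cK KD K0]]].
split; first by move=> m; exact: class_C_coordM.
by exists K; split => // x Kx; rewrite K0// mulr0.
Qed.

Lemma smooth_derivable phi i x : smooth phi -> derivable phi x (basis_vec R i).
Proof. by move=> /(_ 1%N)[_ /(_ i)[]]. Qed.

Lemma derive_coordM phi i j x : smooth phi ->
  'D_(basis_vec R i) (fun y : E => y ord0 j * phi y) x =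
  (i == j)%:R * phi x + x ord0 j * 'D_(basis_vec R i) phi x.
Proof.
move=> sphi; have h2 := derivableP (@smooth_derivable _ i x sphi).
have h1 := is_derive_coord j x (basis_vec R i).
have [_] := is_deriveM h1 h2.
rewrite /GRing.mul/= => ->.
by rewrite /GRing.scale/= /basis_vec mxE eqxx/= eq_sym addrC mulrC.
Qed.

(** Smoothness matters: where a derivative does not exist, ['D_v] has a default value that need not
    be linear. *)
Lemma jet_of_lincomb c phi psi : smooth phi -> smooth psi ->
  jet_of (fun x => c * phi x + psi x) = c *: jet_of phi + jet_of psi.
Proof.
move=> sphi spsi; congr pair; apply/funext => x; apply/rowP => i.
rewrite mxE; have [_ ->] := derive_lincomb c (@smooth_derivable _ i x sphi)
  (@smooth_derivable _ i x spsi).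
by rewrite /= !mxE.
Qed.

End test_functions.

(** * The spaces H^1 and H^1_0 *)

Section sobolev_spaces.
Context (R : realType) (d : nat).
Local Notation E := 'rV[R]_d.
Local Notation leb := (@lebesgue R d).
Variable D : set E.
Hypotheses (oD : open D) (bD : bounded_set D).

Let mD : measurable D := open_measurable_rV oD.

Lemma continuous_L2s (phi : E -> R) : continuous phi -> L2s D phi.
Proof.
move=> cphi; apply: continuous_square_integrable => //.
exact: continuous_subspaceT.
Qed.

Lemma smooth_L2jet (phi : E -> R) : smooth phi -> L2jet D (jet_of phi).
Proof.
move=> sphi; split=> [|i].
  exact: continuous_L2s (class_C_continuous (sphi 0%N)).
under eq_fun do rewrite mxE; apply: continuous_L2s.
by have [_ /(_ i)[_ []]] := sphi 1%N.
Qed.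

Lemma H1_L2jet : H1 D `<=` L2jet D.
Proof. by move=> u [u1 u2]; split=> // i; have [] := u2 i. Qed.

Lemma subspace_H1 : subspace_set (H1 D).
Proof.
have [s0 s] := subspace_L2jet mD.
have is_H1 u : L2jet D u ->
    (forall i, weak_pderiv D i u.1 (fun x => u.2 x ord0 i)) ->
    H1 D u.
  by move=> [u1 u2] w; split.
split=> [|c u v Hu Hv].
  have z (f : E -> R) : \int[leb]_(x in D) (0 * f x) = 0.
    under eq_Rintegral do rewrite mul0r.
    by rewrite Rintegral_cst// mul0r.
  apply: is_H1 => // i phi _; rewrite z.
  under eq_Rintegral do rewrite mxE.
  by rewrite z oppr0.
apply: is_H1; first by apply: s; exact: H1_L2jet.
move=> i phi tphi; have [sphi _] := tphi.
have [u1 /(_ i)[u2 /(_ phi tphi) wu]] := Hu.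
have [v1 /(_ i)[v2 /(_ phi tphi) wv]] := Hv.
have sp : L2s D phi by have [] := smooth_L2jet sphi.
have sd : L2s D ('D_(basis_vec R i) phi).
  have [_ /(_ i)] := smooth_L2jet sphi.
  by under eq_fun do rewrite mxE.
(* Both sides of the weak derivative identity are inner products against a fixed function, here the
   derivative of [phi] and next [phi] itself, hence linear in the jet. *)
have := semi_innerZDl (semi_inner_s mD) c u1 v1 sd.
rewrite /inner_s wu wv => ->.
have := semi_innerZDl (semi_inner_s mD) c u2 v2 sp.
rewrite /inner_s => h; rewrite mulrN -opprD -h; congr (- _).
by apply: eq_Rintegral => x _; rewrite !mxE.
Qed.

Lemma H10_H1 : H10 D `<=` H1 D.
Proof. by move=> u []. Qed.

Lemma subspace_H10 : subspace_set (H10 D).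
Proof.
have [H10 Hlin] := subspace_H1.
split=> [|c u v [Hu au] [Hv av]].
  split=> // e e0; exists (fun=> 0); first exact: test_fun0.
  rewrite (_ : jet_of _ = 0) ?subrr ?H1_norm0//.
  congr pair; apply/funext => x; apply/rowP => i; rewrite !mxE.
  exact: derive_cst.
split; first exact: Hlin.
(* Chosen so that |c| e' + e' = e. *)
move=> e e0; pose e' := e / (`|c| + 1).
have e'0 : 0 < e' by rewrite divr_gt0// ltr_wpDl.
have [phi tphi Hphi] := au _ e'0; have [psi tpsi Hpsi] := av _ e'0.
exists (fun x => c * phi x + psi x); first exact: test_fun_lincomb.
have [sphi _] := tphi; have [spsi _] := tpsi.
have Ju := H1_L2jet Hu; have Jv := H1_L2jet Hv.
have Jphi := smooth_L2jet sphi; have Jpsi := smooth_L2jet spsi.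
have Sj := subspace_L2jet mD.
have Jup := subspace_setB Sj Ju Jphi; have Jvp := subspace_setB Sj Jv Jpsi.
rewrite jet_of_lincomb// opprD addrACA -scalerBr.
have Jcup := subspace_setZ c Sj Jup.
apply: (le_lt_trans (H1_normD mD Jcup Jvp)); rewrite (H1_normZ mD)//.
have <- : `|c| * e' + e' = e.
  by rewrite -[X in _ + X]mul1r -mulrDl mulrC divfK// gt_eqF// ltr_wpDl.
exact: ler_ltD (ler_wpM2l (normr_ge0 c) (ltW Hphi)) Hpsi.
Qed.

Lemma norm_s_coord (F : E -> E) i : L2v D F ->
  semi_norm (inner_s D) (fun x => F x ord0 i) <= semi_norm (inner_v D) F.
Proof.
move=> sF; rewrite ler_wsqrtr//; apply: le_Rintegral => //.
- exact: square_integrableM.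
- exact: dotv_integrable.
- move=> x _; rewrite /dotv (bigD1 i)//= lerDl.
  by apply: sumr_ge0 => j _; rewrite -expr2 sqr_ge0.
Qed.

(* Testing the weak derivative of [u] against [x_i * phi] and letting [phi]
   tend to [u] gives [int u^2 = - 2 int x_i u (d_i u)]. *)
Lemma poincare (i : 'I_d) (M : R) u : 0 <= M ->
  (forall x, D x -> `|x ord0 i| <= M) -> H10 D u ->
  semi_norm (inner_s D) u.1 <= 2 * M * semi_norm (inner_v D) u.2.
Proof.
move=> M0 DM [Hu au]; have [u1 u2] := H1_L2jet Hu.
have ss := semi_inner_s mD; have sv := semi_inner_v mD.
set a := semi_norm _ u.1; set b := semi_norm _ u.2.
have a0 : 0 <= a := semi_norm_ge0 _ _; have b0 : 0 <= b := semi_norm_ge0 _ _.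
suff : a ^+ 2 <= 2 * M * b * a.
  have [->|an0] := eqVneq a 0; first by rewrite !mulr_ge0.
  by rewrite expr2 ler_pM2r// lt_def an0.
apply/ler_addgt0Pr => e e0; pose K := a + M * a + M * b + 1.
have K0 : 0 < K by rewrite /K ltr_wpDl// !addr_ge0// mulr_ge0.
have [phi tphi Hphi] := au (e / K) (divr_gt0 e0 K0).
set dl := H1_norm _ _ in Hphi; have [sphi _] := tphi.
have [p1 p2] := smooth_L2jet sphi.
have Jup : L2jet D (u - jet_of phi).
  exact: (subspace_setB (subspace_L2jet mD)).
have dl1 : semi_norm (inner_s D) (u.1 - phi) <= dl by have := norm_s_le mD Jup.
have dl2 : semi_norm (inner_v D) (u.2 - grad phi) <= dl by have := norm_v_le mD Jup.
have dl0 : 0 <= dl by apply: le_trans dl1; exact: semi_norm_ge0.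
pose w := fun x => u.2 x ord0 i : R^o.
pose dphi := 'D_(basis_vec R i) phi : E -> R^o.
have sw : L2s D w := u2 i.
have sd : L2s D dphi by have := p2 i; under eq_fun do rewrite mxE.
have nw : semi_norm (inner_s D) w <= b by exact: norm_s_coord.
have nd : semi_norm (inner_s D) dphi <= b + dl.
  have : semi_norm (inner_s D) dphi <= semi_norm (inner_v D) (grad phi).
    have := norm_s_coord i p2; rewrite (_ : (fun _ => _) = dphi)//.
    by apply/funext => x; rewrite mxE.
  move=> /le_trans; apply; apply: le_trans (semi_normB_le sv p2 u2) _.
  by rewrite lerD2l (semi_normBC sv).
have np : semi_norm (inner_s D) phi <= a + dl.
  apply: le_trans (semi_normB_le ss p1 u1) _.
  by rewrite lerD2l (semi_normBC ss).
have mx : measurable_fun D (fun x : E => x ord0 i).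
  by apply: measurable_funTS; exact: measurable_coord.
have sxd := L2s_mulb mD mx DM sd; have sxp := L2s_mulb mD mx DM p1.
have nxd := norm_s_mulb mD M0 mx DM sd; have nxp := norm_s_mulb mD M0 mx DM p1.
have id : inner_s D u.1 phi + inner_s D u.1 (fun x => x ord0 i * dphi x) =
    - inner_s D w (fun x => x ord0 i * phi x).
  have [_ /(_ i)[_ /(_ _ (test_fun_coordM i tphi)) wu]] := Hu.
  rewrite /inner_s -wu -RintegralD//; try exact: square_integrableM.
  apply: eq_Rintegral => x _.
  by rewrite derive_coordM// eqxx mul1r mulrDr.
(* The first term is small; the second is the one that [id] turns into terms carrying the factor
   x_i. *)
have e1 : a ^+ 2 = inner_s D (u.1 - phi) u.1 + inner_s D u.1 phi.
  rewrite (semi_normE ss)// (semi_innerBl ss)//.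
  by rewrite (semi_innerC ss p1 u1) subrK.
have c1 := cauchy_schwarz ss (subspace_setB (subspace_L2s mD) u1 p1) u1.
have c2 := cauchy_schwarz ss u1 sxd; have c3 := cauchy_schwarz ss sw sxp.
move: c1 c2 c3; rewrite -/a.
have := semi_norm_ge0 (inner_s D) (fun x => x ord0 i * dphi x).
have := semi_norm_ge0 (inner_s D) (fun x => x ord0 i * phi x).
have := semi_norm_ge0 (inner_s D) w.
move: nw nxd nxp nd np dl1 id e1.
set I1 := inner_s _ (u.1 - phi) _; set I2 := inner_s _ _ phi.
set I3 := inner_s _ _ _; set I4 := inner_s _ w _.
set n1 := semi_norm _ w; set n2 := semi_norm _ (fun x => _ * dphi x).
set n3 := semi_norm _ (fun x => _ * phi x).
set n4 := semi_norm _ dphi; set n5 := semi_norm _ phi.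
set n6 := semi_norm _ (u.1 - phi).
move=> nw nxd nxp nd np dl1 id e1 n1p n3p n2p c1 c2 c3.
have {}c1 : I1 <= dl * a.
  by apply: le_trans (ler_norm _) (le_trans c1 _); rewrite ler_wpM2r.
have {}c2 : - I3 <= a * (M * (b + dl)).
  rewrite -normrN in c2.
  apply: le_trans (ler_norm _) (le_trans c2 _); rewrite ler_wpM2l//.
  by apply: le_trans nxd _; rewrite ler_wpM2l.
have {}c3 : - I4 <= b * (M * (a + dl)).
  rewrite -normrN in c3.
  apply: le_trans (ler_norm _) (le_trans c3 _); apply: ler_pM => //.
  by apply: le_trans nxp _; rewrite ler_wpM2l.
have h : dl * K <= e by rewrite -ler_pdivlMr// ltW.
apply: le_trans (lerD (lexx (2 * M * b * a)) h); rewrite e1 /K.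
clearbody I1 I2 I3 I4.
clear -c1 c2 c3 id dl0.
have -> : I2 = - I3 - I4 by rewrite -id; ring.
nra.
Qed.

(** On H^1_0 the gradient controls the whole norm: the Poincare constant 2 M accounts for the
    function and 1 for the gradient. Positivity of d supplies a coordinate direction. *)
Lemma H10_norm_le (hd : (0 < d)%N) : exists2 C : R, 0 < C &
  forall u, H10 D u -> H1_norm D u <= C * semi_norm (inner_v D) u.2.
Proof.
have [M M0 DM] := ex_strict_bound_gt0 bD.
exists (2 * M + 1); first by rewrite addr_gt0// mulr_gt0.
move=> u Hu; apply: le_trans (H1_norm_le mD (H1_L2jet (H10_H1 Hu))) _.
rewrite mulrDl mul1r lerD2r; apply: (poincare (i := Ordinal hd)) => //.
  exact: ltW.
by move=> x Dx; apply: le_trans (coord_le_norm x _) (ltW (DM _ Dx)).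
Qed.

(** Continuity at 0 plus scaling. Since the seminorm of u may vanish, u is rescaled by dl / t with t
    = |u| + dl e, which gives |L u| <= |u| / dl + e for every e > 0. *)
Lemma H1_functional_bounded (S : set (jet R d)) (W : normedModType R)
    (L : jet R d -> W) : S `<=` L2jet D -> subspace_set S ->
  continuous_linear D S L ->
  exists2 K : R, 0 < K & forall u, S u -> `|L u| <= K * H1_norm D u.
Proof.
move=> SJ sS [Llin Lcont]; have [S0 _] := sS.
have L0 : L 0 = 0.
  have := Llin 1 0 0 S0 S0; rewrite scale1r addr0 scale1r => h.
  by apply: (@addrI _ (L 0)); rewrite addr0 -h.
have LZ c u : S u -> L (c *: u) = c *: L u.
  by move=> Su; have := Llin c u 0 Su S0; rewrite !addr0 L0 addr0.
have [dl dl0 Ldl] := Lcont 0 S0 1 ltr01.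
exists dl^-1; first by rewrite invr_gt0.
move=> u Su; apply/ler_addgt0Pr => e e0.
have N0 : 0 <= H1_norm D u by exact: sqrtr_ge0.
pose t := H1_norm D u + dl * e.
have t0 : 0 < t by rewrite ltr_wpDl// mulr_gt0.
have c0 : 0 < dl / t by rewrite divr_gt0.
have h : dl / t * H1_norm D u < dl.
  by rewrite mulrAC ltr_pdivrMr// ltr_pM2l// /t ltrDl mulr_gt0.
have := Ldl ((dl / t) *: u) (subspace_setZ _ sS Su).
rewrite !subr0 L0 subr0 LZ// (H1_normZ mD); last exact: SJ.
rewrite (gtr0_norm c0) normrZ (gtr0_norm c0) => /(_ h).
rewrite mulrAC ltr_pdivrMr// mul1r => /ltW; rewrite -ler_pdivlMl// mulrDr.
by rewrite mulKf ?gt_eqF.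
Qed.

End sobolev_spaces.

(** * Energy and stability estimates *)

Section elliptic.
Context (R : realType) (d : nat).
Local Notation E := 'rV[R]_d.
Local Notation leb := (@lebesgue R d).
Variable D : set E.
Hypotheses (oD : open D) (bD : bounded_set D).

Let mD : measurable D := open_measurable_rV oD.

Variables (f : jet R d -> R^o) (G : jet R d).
Hypothesis HG : H1 D G.

(** The equation of [weak_solution] for an arbitrary coefficient k. *)
Definition weak_eq (k : E -> R) (q : jet R d) := forall phi, H10 D phi ->
  \int[leb]_(x in D) (k x * dotv (q.2 x) (phi.2 x)) =
  f phi - \int[leb]_(x in D) (k x * dotv (G.2 x) (phi.2 x)).

Lemma weighted_inner (k : E -> R) (F H : E -> E) :
  \int[leb]_(x in D) (k x * dotv (F x) (H x)) =
  inner_v D (fun x => k x *: F x) H.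
Proof. by apply: eq_Rintegral => x _; rewrite dotvZl. Qed.

Lemma inner_v_coercive (k : E -> R) (c M : R) F : measurable_fun D k ->
  (forall x, D x -> `|k x| <= M) -> (forall x, D x -> c <= k x) -> L2v D F ->
  c * semi_norm (inner_v D) F ^+ 2 <= inner_v D (fun x => k x *: F x) F.
Proof.
move=> mk kM ck sF; rewrite (semi_normE (semi_inner_v mD))//.
rewrite -RintegralZl//; last exact: dotv_integrable.
apply: le_Rintegral => //.
- by apply: integrable_scale => //; exact: dotv_integrable.
- by apply: dotv_integrable => //; exact: L2v_mulb mk kM sF.
- by move=> x Dx; rewrite dotvZl ler_wpM2r ?dotvv_ge0// ck.
Qed.

Let H10_L2v q : H10 D q -> L2v D q.2.
Proof. by move=> /H10_H1/H1_L2jet[]. Qed.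

Let GL2v : L2v D G.2. Proof. by have [] := H1_L2jet HG. Qed.

(** Testing with q itself gives c a^2 <= K C a + M g a, where a and g are the L^2 norms of the
    gradients of q and G; then one factor a is cancelled. *)
Lemma energy_estimate (k : E -> R) (c M K C : R) q :
  0 < c -> 0 <= M -> 0 <= K -> 0 <= C ->
  (forall u, H10 D u -> `|f u| <= K * H1_norm D u) ->
  (forall u, H10 D u -> H1_norm D u <= C * semi_norm (inner_v D) u.2) ->
  measurable_fun D k ->
  (forall x, D x -> `|k x| <= M) -> (forall x, D x -> c <= k x) ->
  H10 D q -> weak_eq k q ->
  semi_norm (inner_v D) q.2 <= (K * C + M * semi_norm (inner_v D) G.2) / c.
Proof.
move=> c0 M0 K0 C0 fK HC mk kM ck Hq wq.
have := wq q Hq; rewrite !weighted_inner.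
have sq := H10_L2v Hq; have sv := semi_inner_v mD.
have := inner_v_coercive mk kM ck sq.
have skG := L2v_mulb mD mk kM GL2v.
have := cauchy_schwarz sv skG sq; have := norm_v_mulb mD M0 mk kM GL2v.
have := ler_wpM2l K0 (HC _ Hq); have := fK _ Hq.
have := semi_norm_ge0 (inner_v D) q.2; have := semi_norm_ge0 (inner_v D) G.2.
move: (inner_v D _ q.2) => I1; move: (inner_v D _ q.2) => I2.
move: (semi_norm _ q.2) => a; move: (semi_norm _ (fun x => k x *: G.2 x)) => b.
move: (semi_norm _ G.2) => g; move: (f q) (H1_norm D q) => fq h.
move=> g0 a0 fqh hCa bg I1b I2c I2E.
rewrite ler_pdivlMr//; have [->|an0] := eqVneq a 0.
  by rewrite mul0r addr_ge0// mulr_ge0.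
have {an0}a1 : 0 < a by rewrite lt_def an0.
rewrite -(ler_pM2r a1).
have := ler_wpM2r a0 bg; move: fqh I1b.
rewrite !ler_norml => /andP[_ h1] /andP[h2 _].
nra.
Qed.

Lemma stability_estimate (k1 k2 : E -> R) (c M : R) q1 q2 :
  0 < c -> measurable_fun D k1 -> measurable_fun D k2 ->
  (forall x, D x -> `|k1 x| <= M) -> (forall x, D x -> `|k2 x| <= M) ->
  (forall x, D x -> c <= k1 x) ->
  H10 D q1 -> H10 D q2 -> weak_eq k1 q1 -> weak_eq k2 q2 ->
  c * semi_norm (inner_v D) (q1 - q2).2 <=
  semi_norm (inner_v D) (fun x => (k2 x - k1 x) *: (q2 + G).2 x).
Proof.
move=> c0 mk1 mk2 kM1 kM2 ck1 Hq1 Hq2 wq1 wq2.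
have sv := semi_inner_v mD; have SV := subspace_L2v mD.
have Hw := subspace_setB (subspace_H10 oD bD) Hq1 Hq2; set w := q1 - q2 in Hw *.
have s1 := H10_L2v Hq1; have s2 := H10_L2v Hq2; have sw := H10_L2v Hw.
have := wq1 _ Hw; have := wq2 _ Hw; rewrite !weighted_inner => e2 e1.
have s11 := L2v_mulb mD mk1 kM1 s1; have s12 := L2v_mulb mD mk1 kM1 s2.
have s22 := L2v_mulb mD mk2 kM2 s2; have sG1 := L2v_mulb mD mk1 kM1 GL2v.
have sG2 := L2v_mulb mD mk2 kM2 GL2v.
have := inner_v_coercive mk1 kM1 ck1 sw.
set F := fun x => (k2 x - k1 x) *: (q2 + G).2 x.
(* Paired with the gradient of w, the first two terms give f w by the equation of [q2]; subtracting
   the third gives the k1-weighted product of [q1] and w by the equation of [q1]; the last one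
   leaves the k1-energy of w. *)
have FE : F = (fun x => k2 x *: q2.2 x) + (fun x => k2 x *: G.2 x)
    - (fun x => k1 x *: G.2 x) - (fun x => k1 x *: q2.2 x).
  suff h x : (k2 x - k1 x) *: (q2.2 x + G.2 x) =
      k2 x *: q2.2 x + k2 x *: G.2 x - k1 x *: G.2 x - k1 x *: q2.2 x.
    by apply/funext => x; exact: h.
  by apply/rowP => j; rewrite !mxE; ring.
have S1 := subspace_setD SV s22 sG2.
have S2 := subspace_setB SV S1 sG1.
have sF : L2v D F by rewrite FE; exact: (subspace_setB SV S2 s12).
have -> : inner_v D (fun x => k1 x *: w.2 x) w.2 = inner_v D F w.2.
  rewrite FE (semi_innerBl sv S2 s12 sw) (semi_innerBl sv S1 sG1 sw).
  rewrite (semi_innerDl sv s22 sG2 sw) e2 subrK -e1.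
  rewrite -(semi_innerBl sv s11 s12 sw); congr (inner_v D _ _).
  by apply/funext => x; exact: scalerBr.
move=> h; have := cauchy_schwarz sv sF sw.
move=> /(le_trans (ler_norm _))/(le_trans h).
have := semi_norm_ge0 (inner_v D) w.2; have := semi_norm_ge0 (inner_v D) F.
move: (semi_norm _ F) (semi_norm _ w.2) => a b a0 b0.
have [->|bn0] := eqVneq b 0; first by rewrite !mulr0.
by rewrite expr2 mulrA ler_pM2r// lt_def bn0.
Qed.

End elliptic.

(** * The coefficient of the elliptic problem *)

Lemma C1_bounds (R : realType) (sigma : R -> R) (r : R) :
  0 < r -> (forall t, 0 < sigma t) -> (forall t, derivable sigma t 1) ->
  continuous (derive1 sigma) ->
  exists c M L : R, [/\ 0 < c, 0 < M, 0 < L,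
    forall t, `|t| <= r -> c <= sigma t <= M &
    forall s t, `|s| <= r -> `|t| <= r -> `|sigma s - sigma t| <= L * `|s - t|].
Proof.
move=> r0 spos sder sC1.
have scont : continuous sigma.
  by move=> t; apply: differentiable_continuous; exact/derivable1_diffP.
have rr : - r <= r by rewrite ge0_cp// ltW.
have inr t : `|t| <= r -> t \in `[- r, r]%R by rewrite in_itv/= ler_norml.
have [t1 _ minP] := EVT_min rr (continuous_subspaceT scont).
have [t2 _ maxP] := EVT_max rr (continuous_subspaceT scont).
have ncont : continuous (fun t => `|derive1 sigma t|).
  by move=> t; apply: cvg_norm; exact: sC1.
have [t3 _ derP] := EVT_max rr (continuous_subspaceT ncont).
(* The lower bound is positive because it is an attained value of [sigma]. The Lipschitz constant
   comes from the mean value theorem, with 1 added to make it positive. *)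
exists (sigma t1), (sigma t2), (`|derive1 sigma t3| + 1); split => //.
  by move=> t /inr tr; rewrite minP// maxP.
move=> s t; wlog st : s t / s <= t.
  move=> H sr tr; have [|/ltW] := leP s t; first by move=> st; exact: H.
  by move=> ts; rewrite distrC (distrC s); exact: H.
move=> /inr sr /inr tr.
have [||x xst e] := @MVT_segment R sigma (derive1 sigma) s t st.
- by move=> x _; rewrite derive1E; exact: derivableP.
- exact: continuous_subspaceT.
rewrite distrC e normrM (distrC s) ler_wpM2r//.
rewrite (@le_trans _ _ `|derive1 sigma t3|)// ?lerDl// derP//.
move: xst sr tr; rewrite !in_itv/= => /andP[a b] /andP[a' _] /andP[_ b'].
by rewrite (le_trans a')// (le_trans b).
Qed.

(** * Comparison of the Euclidean norm with the maximum norm *)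

Section euclidean.
Context (R : realType) (n : nat).
Implicit Types x : 'rV[R]_n.

Lemma coord_le_eucl x i : `|x ord0 i| <= eucl x.
Proof.
rewrite /eucl -sqrtr_sqr ler_wsqrtr// /dotv (bigD1 i)//= -expr2 lerDl.
by apply: sumr_ge0 => j _; rewrite -expr2 sqr_ge0.
Qed.

Lemma eucl_le_norm x : eucl x <= Num.sqrt n%:R * `|x|.
Proof.
have -> : `|x| = Num.sqrt (`|x| ^+ 2) by rewrite sqrtr_sqr normr_id.
rewrite -sqrtrM// ler_wsqrtr//.
rewrite mulr_natl -[X in _ *+ X]card_ord -sumr_const; apply: ler_sum => i _.
rewrite -expr2 -[leLHS]real_normK ?num_real// lerXn2r ?nnegrE//.
exact: coord_le_norm.
Qed.

End euclidean.

(** * Measurability and bounds for the glued function u^a *)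

Section glueing.
Context (R : realType) (d N : nat).
Local Notation E := 'rV[R]_d.
Variable D : set E.
Hypotheses (oD : open D) (bD : bounded_set D).
Implicit Types (u v : E -> 'rV[R]_N) (A : 'I_N -> set E).

Let mD : measurable D := open_measurable_rV oD.

Lemma eucl_le_sup_norm u x : CX D u -> closure D x -> eucl (u x) <= sup_norm D u.
Proof.
move=> cu Dx; apply: ub_le_sup; last by exists x.
(* The supremum dominates its set only if that set is bounded above; compactness of the closure
   ensures it. *)
have /compact_bounded/ex_strict_bound_gt0[M M0 uM] :=
  continuous_compact cu (bounded_closure_compact bD).
exists (Num.sqrt N%:R * M) => _ [y Dy <-].
apply: le_trans (eucl_le_norm _) _; rewrite ler_wpM2l ?sqrtr_ge0// ltW//.
by apply: uM; exists y.
Qed.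

Lemma CXB u v : CX D u -> CX D v -> CX D (u \- v).
Proof. by move=> cu cv x; apply: cvgB; [exact: cu|exact: cv]. Qed.

Lemma glueE A u x i : trivIset setT A -> A i x -> Defs.glue A u x = u x ord0 i.
Proof.
move=> tA Aix; rewrite /Defs.glue (bigD1 i)//= indicE mem_set// mulr1 big1 ?addr0//.
move=> j ji; rewrite indicE memNset ?mulr0// => Ajx.
by move/eqP: ji; apply; apply: tA => //; exists x.
Qed.

Lemma partition_ex A x : is_partition D A -> D x -> exists i, A i x.
Proof. by move=> [_ _ <-] [i _ Aix]; exists i. Qed.

Lemma glue_measurable A u : is_partition D A -> CX D u ->
  measurable_fun D (Defs.glue A u).
Proof.
move=> [mA _ _] cu; apply: measurable_sum => i.
apply: measurable_funM; last by apply: measurable_indic; exact: mA.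
apply: continuous_measurable_rV => //.
apply: (@continuous_subspaceW _ _ D (closure D)); first exact: subset_closure.
move=> x; apply: (@cvg_comp _ _ _ u (fun y : 'rV[R]_N => y ord0 i)).
  exact: cu.
exact: coord_continuous.
Qed.

Lemma glue_le_sup_norm A u x : is_partition D A -> CX D u -> D x ->
  `|Defs.glue A u x| <= sup_norm D u.
Proof.
move=> pA cu Dx; have [i Aix] := partition_ex pA Dx; have [_ tA _] := pA.
rewrite (glueE u tA Aix); apply: le_trans (coord_le_eucl _ _) _.
by apply: eucl_le_sup_norm => //; exact: subset_closure.
Qed.

Lemma glueB A u v x : Defs.glue A u x - Defs.glue A v x = Defs.glue A (u \- v) x.
Proof.
rewrite /Defs.glue -sumrB; apply: eq_bigr => i _.
by rewrite -mulrBl !mxE.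
Qed.

Lemma glue_eq A B u x : is_partition D A -> is_partition D B -> D x ->
  ~ (\big[setU/set0]_(i < N) (A i `+` B i)) x -> Defs.glue A u x = Defs.glue B u x.
Proof.
move=> pA [_ tB _] Dx nS; have [i Aix] := partition_ex pA Dx.
have [_ tA _] := pA; rewrite (glueE u tA Aix) (@glueE B u x i)//.
apply: contrapT => nB; apply: nS; rewrite -bigcup_seq/=; exists i => //=.
  by rewrite mem_index_enum.
by left.
Qed.

End glueing.

Lemma measure_bigsetU_le d (T : measurableType d) (R : realType)
    (mu : {measure set T -> \bar R}) (N : nat) (F : 'I_N -> set T) :
  (forall i, measurable (F i)) ->
  (mu (\big[setU/set0]_(i < N) F i) <= \sum_(i < N) mu (F i))%E.
Proof.
move=> mF; suff [] : measurable (\big[setU/set0]_(i < N) F i) /\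
  (mu (\big[setU/set0]_(i < N) F i) <= \sum_(i < N) mu (F i))%E by [].
(* Measurability is carried through the induction because subadditivity for two sets asks for it. *)
apply: (@big_ind2 _ _ (fun A x => measurable A /\ (mu A <= x)%E)) => //.
  by rewrite measure0.
move=> A x B y [mA Ax] [mB By]; split; first exact: measurableU.
by have /le_trans := @measureU2 _ _ _ mu A B mA mB; apply; exact: leeD.
Qed.

(** * The forward operator *)

(** Absolute continuity of the integral of |F|^2: the square of the seminorm is at most M^2 times
    that integral over S. The threshold depends on F, M and e, but not on k or S. *)
Lemma norm_v_small_support (R : realType) (d : nat) (D : set 'rV[R]_d) F (M e : R) :
  measurable D -> L2v D F -> 0 <= M -> 0 < e ->
  exists2 dl : R, 0 < dl & forall (k : 'rV[R]_d -> R) S,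
    measurable S -> (lebesgue S < dl%:E)%E -> measurable_fun D k ->
    (forall x, D x -> `|k x| <= M) -> (forall x, D x -> ~ S x -> k x = 0) ->
    semi_norm (inner_v D) (fun x => k x *: F x) < e.
Proof.
move=> mD sF M0 e0; have M1 : 0 < M + 1 by rewrite ltr_wpDl.
pose h x := dotv (F x) (F x).
have ih : lebesgue.-integrable D (EFin \o h) := dotv_integrable mD sF sF.
have ihT : lebesgue.-integrable setT (EFin \o (h \_ D)).
  by rewrite -restrict_EFin; exact: (integrable_mkcond _ mD).1 ih.
(* M + 1 stands in for M, which may be 0. *)
have e'0 : 0 < (e / (M + 1)) ^+ 2 by rewrite exprn_gt0// divr_gt0.
have [dl [dl0 hdl]] := integral_normr_continuous ihT e'0.
exists dl => // k S mS Sdl mk kM k0.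
have mDS : measurable (D `&` S) by exact: measurableI.
have DSdl : (lebesgue (D `&` S) < dl%:E)%E.
  by apply: le_lt_trans Sdl; apply: le_measure; rewrite ?inE//; exact: subIsetr.
have := hdl _ mDS DSdl.
rewrite (_ : \int[lebesgue]_(x in D `&` S) `|(h \_ D) x| =
    \int[lebesgue]_(x in D) (h \_ S) x); last first.
  rewrite -Rintegral_mkcondr; apply: eq_Rintegral => x; rewrite inE => -[Dx _].
  by rewrite patchE mem_set// ger0_norm// dotvv_ge0.
move=> hS; rewrite -(@ltr_pXn2r _ 2)// ?nnegrE ?semi_norm_ge0 ?ltW//.
have skF := L2v_mulb mD mk kM sF.
rewrite (semi_normE (semi_inner_v mD))//.
have ihS : lebesgue.-integrable D (EFin \o (h \_ S)).
  rewrite -restrict_EFin; apply/integrable_restrict => //.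
  exact: integrableS ih.
apply: (@le_lt_trans _ _ (M ^+ 2 * \int[lebesgue]_(x in D) (h \_ S) x)).
  rewrite -RintegralZl//; apply: le_Rintegral => //.
  - exact: dotv_integrable.
  - exact: integrable_scale.
  - move=> x Dx; rewrite dotvZl dotvC dotvZl mulrA -expr2 patchE.
    case: (boolP (x \in S)) => [_|]; last first.
      by rewrite notin_setE => /(k0 _ Dx) ->; rewrite expr0n/= !mul0r mulr0.
    rewrite ler_wpM2r ?dotvv_ge0//.
    by rewrite -[_ ^+ 2]real_normK ?num_real// lerXn2r ?nnegrE// kM.
apply: (@le_lt_trans _ _ ((M + 1) ^+ 2 * \int[lebesgue]_(x in D) (h \_ S) x)).
  rewrite ler_wpM2r//; last by rewrite lerXn2r ?nnegrE ?lerDl// ltW.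
  apply: Rintegral_ge0 => x _; rewrite patchE; case: ifP => // _.
  exact: dotvv_ge0.
by move: hS; rewrite expr_div_n ltr_pdivlMr ?exprn_gt0// mulrC.
Qed.

Theorem proposition2p6 (R : realType) (d N k J : nat) (hd : (1 <= d <= 3)%N)
    (D : set 'rV[R]_d) (hD : bounded_lipschitz_domain D)
    (Lam : set 'rV[R]_k) (A : 'rV[R]_k -> 'I_N -> set 'rV[R]_d)
    (hA : forall a, Lam a -> is_partition D (A a))
    (hAcont : forall (i : 'I_N) b, Lam b ->
      lebesgue (A a i `+` A b i) @[a --> within Lam (nbhs b)] --> 0%E)
    (sigma : R -> R) (sigma_gt0 : forall t, 0 < sigma t)
    (sigma_derivable : forall t, derivable sigma t 1)
    (sigma_C1 : continuous (derive1 sigma))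
    (f : jet R d -> R^o) (hf : Hminus1 D f)
    (g : 'rV[R]_d -> R) (hg : H_half D g)
    (G : jet R d) (hG : H1 D G) (hGg : has_trace D G g)
    (ell : jet R d -> 'rV[R]_J) (hell : continuous_linear D (H1 D) ell)
    (p : ('rV[R]_d -> 'rV[R]_N) -> 'rV[R]_k -> jet R d)
    (hp : forall u a, CX D u -> Lam a -> weak_solution D sigma f G (A a) u (p u a)) :
  (forall r : R, 0 < r -> exists2 C : R, 0 < C &
     forall u v, CX D u -> CX D v -> sup_norm D u < r -> sup_norm D v < r ->
     forall a, Lam a ->
       eucl (forward_op ell p u a - forward_op ell p v a) <=
       C * sup_norm D (u \- v)) /\
  (forall u, CX D u -> {within Lam, continuous (forward_op ell p u)}).
Proof.
have [D0 oD _ bD _] := hD; have mD := open_measurable_rV oD.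
have d0 : (0 < d)%N by case/andP: hd.
have sH1 := subspace_H1 oD bD; have sH10 := subspace_H10 oD bD.
have [Kf Kf0 fK] := H1_functional_bounded oD
  (subset_trans (@H10_H1 _ _ D) (@H1_L2jet _ _ D)) sH10 hf.
have [Cp Cp0 HC] := H10_norm_le oD bD d0.
have [Kl Kl0 lK] := H1_functional_bounded oD (@H1_L2jet _ _ D) sH1 hell.
have [ell_lin _] := hell; have sv := semi_inner_v mD.
have GL : L2v D G.2 by have [] := H1_L2jet hG.
have sigma_cont : continuous sigma.
  by move=> t; apply: differentiable_continuous; exact/derivable1_diffP.
pose kap u a x := sigma (Defs.glue (A a) u x).
have mkap u a : CX D u -> Lam a -> measurable_fun D (kap u a).
  move=> cu La; apply: measurableT_comp; first exact: continuous_measurable_fun.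
  by apply: glue_measurable => //; exact: hA.
have glue_r u a r : CX D u -> Lam a -> sup_norm D u <= r ->
    forall x, D x -> `|Defs.glue (A a) u x| <= r.
  move=> cu La ur x Dx; apply: le_trans ur.
  by apply: glue_le_sup_norm => //; exact: hA.
(* P is the energy bound for q plus the gradient norm of the lift G. It is chosen before u and a. *)
have grad_p_bound c M : 0 < c -> 0 <= M -> exists2 P : R, 0 <= P &
    forall u a, CX D u -> Lam a ->
      (forall x, D x -> c <= kap u a x <= M) ->
      L2v D (p u a).2 /\ semi_norm (inner_v D) (p u a).2 <= P.
  move=> c0 M0; exists ((Kf * Cp + M * semi_norm (inner_v D) G.2) / c +
      semi_norm (inner_v D) G.2).
    by rewrite addr_ge0 ?semi_norm_ge0// divr_ge0 ?ltW// ltr_wpDr// ?mulr_ge0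
      ?semi_norm_ge0// mulr_gt0.
  move=> u a cu La kb; have [q Hq [-> wq]] := hp u a cu La.
  have sq : L2v D q.2 by have [] := H1_L2jet (H10_H1 Hq).
  split; first exact: subspace_setD (subspace_L2v mD) sq GL.
  apply: le_trans (semi_normD sv sq GL) _; rewrite lerD2r.
  apply: (energy_estimate oD hG c0 M0 (ltW Kf0) (ltW Cp0) fK HC
    (mkap u a cu La)) => //.
    by move=> x /kb/andP[ck kM]; rewrite ger0_norm// (le_trans (ltW c0)).
  by move=> x /kb/andP[].
(* Both solutions use the same lift G, so it cancels and their difference lies in H^1_0. The
   constant multiplies the bound Kl of [ell], the Poincare-type constant Cp and the 1 / c of the
   stability estimate. *)
have ell_diff c M u a v b : 0 < c -> CX D u -> CX D v -> Lam a -> Lam b ->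
    (forall x, D x -> c <= kap u a x <= M) ->
    (forall x, D x -> c <= kap v b x <= M) ->
    `|forward_op ell p u a - forward_op ell p v b| <= Kl * Cp / c *
      semi_norm (inner_v D) (fun x => (kap v b x - kap u a x) *: (p v b).2 x).
  move=> c0 cu cv La Lb kb1 kb2; rewrite /forward_op.
  have [q1 Hq1 [-> wq1]] := hp u a cu La; have [q2 Hq2 [-> wq2]] := hp v b cv Lb.
  have Hp1 := subspace_setD sH1 (H10_H1 Hq1) hG.
  have Hp2 := subspace_setD sH1 (H10_H1 Hq2) hG.
  have -> : ell (q1 + G) - ell (q2 + G) = ell (q1 - q2).
    have := ell_lin (-1) _ _ Hp2 Hp1; rewrite !scaleN1r => h.
    rewrite [LHS]addrC -h; congr (ell _).
    by rewrite addrC opprD addrACA subrr addr0.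
  have Hw := subspace_setB sH10 Hq1 Hq2.
  apply: le_trans (lK _ (H10_H1 Hw)) _.
  rewrite -!mulrA ler_pM2l//; apply: le_trans (HC _ Hw) _.
  rewrite ler_pM2l// ler_pdivlMl//.
  have kn x : D x -> `|kap u a x| <= M /\ `|kap v b x| <= M.
    move=> Dx; have /andP[c1 M1] := kb1 x Dx; have /andP[c2 M2] := kb2 x Dx.
    have n0 y : c <= y -> 0 <= y := le_trans (ltW c0).
    by rewrite (ger0_norm (n0 _ c1)) (ger0_norm (n0 _ c2)).
  apply: (@stability_estimate _ _ _ oD bD f G hG _ _ _ M _ _ c0
    (mkap u a cu La) (mkap v b cv Lb)) => // x.
  - by move=> /kn[].
  - by move=> /kn[].
  - by move=> /kb1/andP[].
split.
  move=> r r0; have [c [M [L [c0 M0 L0 sb sL]]]] :=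
    C1_bounds r0 sigma_gt0 sigma_derivable sigma_C1.
  have [P P0 hP] := grad_p_bound c M c0 (ltW M0).
  (* The square root of J passes from the maximum norm of R^J to the Euclidean one; L bounds the
     variation of [sigma] and P the gradient of the second solution. C may be 0, hence C + 1
     below. *)
  pose C := Num.sqrt J%:R * (Kl * Cp / c * (L * P)).
  have C0 : 0 <= C.
    by rewrite !mulr_ge0 ?sqrtr_ge0 ?invr_ge0// ltW.
  exists (C + 1); first by rewrite ltr_wpDl.
  move=> u v cu cv ur vr a La; have cuv := CXB cu cv.
  have S0 : 0 <= sup_norm D (u \- v).
    have [x Dx] := D0; apply: le_trans (eucl_le_sup_norm bD cuv (subset_closure Dx)).
    exact: sqrtr_ge0.
  have gu := glue_r u a r cu La (ltW ur); have gv := glue_r v a r cv La (ltW vr).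
  have kbu x : D x -> c <= kap u a x <= M by move=> Dx; apply: sb; exact: gu.
  have kbv x : D x -> c <= kap v a x <= M by move=> Dx; apply: sb; exact: gv.
  have [pL pP] := hP v a cv La kbv.
  apply: (@le_trans _ _ (C * sup_norm D (u \- v)));
    last by rewrite ler_wpM2r// lerDl.
  apply: le_trans (eucl_le_norm _) _.
  rewrite /C -mulrA ler_wpM2l ?sqrtr_ge0//.
  apply: le_trans (ell_diff c M u a v a c0 cu cv La La kbu kbv) _.
  rewrite -[leRHS]mulrA.
  rewrite ler_wpM2l ?mulr_ge0 ?invr_ge0 ?(ltW Kl0) ?(ltW Cp0) ?(ltW c0)//.
  have kd x : D x -> `|kap v a x - kap u a x| <= L * sup_norm D (u \- v).
    move=> Dx; rewrite distrC; apply: le_trans (sL _ _ (gu x Dx) (gv x Dx)) _.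
    rewrite ler_pM2l// glueB; apply: glue_le_sup_norm => //; exact: hA.
  apply: le_trans (norm_v_mulb mD _ _ kd pL) _.
  - by rewrite mulr_ge0// ltW.
  - by apply: measurable_funB; exact: mkap.
  - by rewrite mulrAC ler_wpM2r// ler_wpM2l// ltW.
move=> u cu; apply/subspace_continuousP => b Lb.
(* Adding 1 keeps the radius positive when u = 0. *)
pose r := sup_norm D u + 1.
have r0 : 0 < r.
  rewrite ltr_wpDl//; have [x Dx] := D0.
  by apply: le_trans (eucl_le_sup_norm bD cu (subset_closure Dx)); exact: sqrtr_ge0.
have [c [M [L [c0 M0 L0 sb sL]]]] :=
  C1_bounds r0 sigma_gt0 sigma_derivable sigma_C1.
have kb a x : Lam a -> D x -> c <= kap u a x <= M.
  by move=> La Dx; apply: sb; apply: (glue_r u a r cu La) => //; rewrite lerDl.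
have [P P0 hP] := grad_p_bound c M c0 (ltW M0).
have [pL _] := hP u b cu Lb (fun x => kb b x Lb).
apply/cvgrPdist_lt => e e0; pose K := Kl * Cp / c.
have K0 : 0 < K by rewrite divr_gt0// mulr_gt0.
have [dl dl0 hdl] := norm_v_small_support mD pL (ltW M0) (divr_gt0 e0 K0).
(* N sets of measure below dl / (N + 1) have total measure strictly below dl, also when N = 0. *)
have N0 : 0 < dl / N.+1%:R by rewrite divr_gt0.
have : \forall a \near within Lam (nbhs b),
    forall i, (lebesgue (A a i `+` A b i) < (dl / N.+1%:R)%:E)%E.
  apply: filter_forall => i.
  by apply: (hAcont i b Lb [set y | (y < _)%E]); apply: open_ereal_lt';
    rewrite lte_fin.
move=> near_small; near=> a.
have La : Lam a by near: a; exact: withinT.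
have small : forall i, (lebesgue (A a i `+` A b i) < (dl / N.+1%:R)%:E)%E.
  by near: a.
have mA : forall i, measurable (A a i `+` A b i).
  move=> i; have [ma _ _] := hA a La; have [mb _ _] := hA b Lb.
  by apply: measurableU; apply: measurableD.
(* The order matters: the limit parameter b comes second, so the gradient in the bound is the one
   for which [dl] was chosen. *)
rewrite distrC; apply: le_lt_trans (ell_diff c M u a u b c0 cu cu La Lb _ _) _.
- by move=> x; exact: kb.
- by move=> x; exact: kb.
rewrite -/K mulrC -ltr_pdivlMr//.
apply: (hdl _ (\big[setU/set0]_(i < N) (A a i `+` A b i))).
- exact: bigsetU_measurable.
- apply: le_lt_trans (measure_bigsetU_le _ mA) _.
  apply: (@le_lt_trans _ _ (\sum_(i < N) (dl / N.+1%:R)%:E)%E).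
    by apply: lee_sum => i _; exact: ltW (small i).
  rewrite sumEFin lte_fin sumr_const card_ord -[ltLHS]mulr_natr mulrAC.
  by rewrite ltr_pdivrMr// ltr_pM2l// ltr_nat.
- by apply: measurable_funB; exact: mkap.
- move=> x Dx; have /andP[c1 M1] := kb a x La Dx; have /andP[c2 M2] := kb b x Lb Dx.
  (* Both coefficients lie in [c, M] with c > 0, so they differ by at most M. *)
  by rewrite ler_norml; apply/andP; split; lra.
- move=> x Dx nS; rewrite /kap (glue_eq u (hA a La) (hA b Lb) Dx nS) subrr.
Unshelve. all: by end_near. Qed.
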